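(* For every $n\ge 2$ and every orientation $\bar G$ of the type $A_{n-1}$ Coxeter diagram, the type $A$ Cambrian lattice $C(\bar G)$ is trim. Equivalently, the set $\mathcal B$ of permutations in $S_n$ avoiding the patterns $\bar 231$ and $31\underline 2$, ordered by weak order, is a trim lattice.
   Context: For $\pi\in S_n$ written as the word $\pi_1\cdots\pi_n$, its inversion set is $\{e_j-e_i: i<j,\ j\text{ precedes } i\text{ in }\pi_1\cdots\pi_n\}$; weak order is inclusion of inversion sets, and is a lattice. The Coxeter diagram is a path $s_1,\dots,s_{n-1}$; an orientation $\bar G$ chooses for each $2\le i\le n-1$ either $s_{i-1}\to s_i$ or $s_{i-1}\leftarrow s_i$. Let $D=\{i\in[2,n-1]: s_{i-1}\to s_i\}$ and $U=\{i\in[2,n-1]: s_{i-1}\leftarrow s_i\}$. A permutation $\pi$ contains $\bar 231$ if there are positions $p<q<r$ with $\pi_r<\pi_p<\pi_q$ and $\pi_p\in U$; it contains $31\underline 2$ if there are positions $p<q<r$ with $\pi_q<\pi_r<\pi_p$ and $\pi_r\in D$. By a result of Reading, $\mathcal B$ is a sublattice of weak order isomorphic to the Cambrian lattice $C(\bar G)$ (a lattice quotient of weak order on $S_n$ whose fibres have minimal elements exactly $\mathcal B$). A finite lattice is trim if, for some $m$, it has a maximal chain of $m+1$ left modular elements (an element $x$ is left modular if $(y\vee x)\wedge z=y\vee(x\wedge z)$ for all $y<z$) and has exactly $m$ join-irreducibles and exactly $m$ meet-irreducibles. *)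

(* Defs.v *)
From mathcomp Require Import all_boot all_fingroup.

Set Implicit Arguments.
Unset Strict Implicit.
Unset Printing Implicit Defensive.

(* Order-theoretic notions, for a relation [le] on a finite type.  Joins and
   meets are relations, since the posets below are not known beforehand to be
   lattices; [is_lattice] provides their existence. *)
Section FiniteOrder.

Variables (T : finType) (le : rel T).

Definition partial_order : Prop :=
  [/\ reflexive le, antisymmetric le & transitive le].

Definition is_join (x y z : T) : bool :=
  [&& le x z, le y z & [forall u, (le x u && le y u) ==> le z u]].

Definition is_meet (x y z : T) : bool :=
  [&& le z x, le z y & [forall u, (le u x && le u y) ==> le u z]].

Definition is_lattice : Prop :=
  partial_order /\
  (forall x y, (exists z, is_join x y z) /\ (exists z, is_meet x y z)).

(* (y \/ x) /\ z = y \/ (x /\ z) for all y < z. *)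
Definition left_modular (x : T) : Prop :=
  forall y z, le y z -> y != z ->
  forall yx xz, is_join y x yx -> is_meet x z xz ->
  exists w, is_meet yx z w /\ is_join y xz w.

(* The first conjunct excludes the bottom (resp. top) element, which is the
   join (resp. meet) of the empty set. *)
Definition join_irreducible (x : T) : bool :=
  [exists y, ~~ le x y] &&
  [forall y, forall z, is_join y z x ==> (x == y) || (x == z)].

Definition meet_irreducible (x : T) : bool :=
  [exists y, ~~ le y x] &&
  [forall y, forall z, is_meet y z x ==> (x == y) || (x == z)].

Definition is_chain (C : {set T}) : bool :=
  [forall x in C, forall y in C, le x y || le y x].

Definition trim : Prop :=
  is_lattice /\
  exists m : nat,
    [/\ exists C : {set T},
          [/\ maxset is_chain C, #|C| = m.+1 & {in C, forall x, left_modular x}],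
        #|[set x | join_irreducible x]| = m
      & #|[set x | meet_irreducible x]| = m].

Definition equivalence_pairs (E : {set T * T}) : bool :=
  [&& [forall x, (x, x) \in E],
      [forall x, forall y, ((x, y) \in E) ==> ((y, x) \in E)]
    & [forall x, forall y, forall z,
         ((x, y) \in E) && ((y, z) \in E) ==> ((x, z) \in E)]].

Definition lattice_congruence (E : {set T * T}) : bool :=
  equivalence_pairs E &&
  [forall x, forall x', forall y, forall y', forall z, forall z',
     ((x, x') \in E) && ((y, y') \in E) ==>
     ((is_join x y z && is_join x' y' z') ||
      (is_meet x y z && is_meet x' y' z')) ==>
     ((z, z') \in E)].

Definition congruence_generated (S : {set T * T}) : {set T * T} :=
  \bigcap_(E : {set T * T} | lattice_congruence E && (S \subset E)) E.

Definition classes_of (E : {set T * T}) : {set {set T}} :=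
  equivalence_partition (fun x y => (x, y) \in E) [set: T].

(* The order of a lattice quotient: one class is below another when some
   representatives are. *)
Definition class_le (A B : {set T}) : bool :=
  [exists x in A, exists y in B, le x y].

End FiniteOrder.

(* The values and positions 1, .., n are shifted to 0, .., n - 1 = 'I_n, and the
   word of s : 'S_n is s 0, s 1, .., so that s^-1 i is the position of i.
   The root e_j - e_i is encoded as the pair (i, j). *)
Definition inversions (n : nat) (s : 'S_n) : {set 'I_n * 'I_n} :=
  [set ij : 'I_n * 'I_n |
     (ij.1 < ij.2) && ((s^-1)%g ij.2 < (s^-1)%g ij.1)].

Definition weak_le (n : nat) : rel 'S_n :=
  fun s t => inversions s \subset inversions t.

(* The shifted indices of the edges s_(i-1) -- s_i of the diagram, 2 <= i <= n-1. *)
Definition interior (n : nat) := {i : 'I_n | 0 < i < n.-1}.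

(* [o i = true] stands for s_(i-1) -> s_i, [o i = false] for s_(i-1) <- s_i. *)
Definition orientation (n : nat) := interior n -> bool.

Definition setD_of (n : nat) (o : orientation n) : {set 'I_n} :=
  [set val i | i : interior n & o i].

Definition setU_of (n : nat) (o : orientation n) : {set 'I_n} :=
  [set val i | i : interior n & ~~ o i].

Definition contains_bar231 (n : nat) (o : orientation n) (s : 'S_n) : bool :=
  [exists p : 'I_n, exists q : 'I_n, exists r : 'I_n,
     [&& p < q, q < r, s r < s p, s p < s q & s p \in setU_of o]].

Definition contains_31bar2 (n : nat) (o : orientation n) (s : 'S_n) : bool :=
  [exists p : 'I_n, exists q : 'I_n, exists r : 'I_n,
     [&& p < q, q < r, s q < s r, s r < s p & s r \in setD_of o]].

Definition avoiders (n : nat) (o : orientation n) : {set 'S_n} :=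
  [set s | ~~ contains_bar231 o s && ~~ contains_31bar2 o s].

(* The generators s_(i-1) and s_i, for i interior (so that ord_pred and ordS do
   not wrap around). *)
Definition gen_before (n : nat) (i : 'I_n) : 'S_n := tperm (ord_pred i) i.
Definition gen_after (n : nat) (i : 'I_n) : 'S_n := tperm i (ordS i).

(* Reading's contracted pairs: t and ts for each arrow s -> t.  The group
   product ts, in which s acts first, is (s * t)%g since MathComp composes
   permutations from left to right.  On three letters, s_1 -> s_2 contracts 132
   and 312, and s_1 <- s_2 contracts 213 and 231. *)
Definition contracted_pairs (n : nat) (o : orientation n) : {set 'S_n * 'S_n} :=
  [set (gen_after i, (gen_before i * gen_after i)%g) | i in setD_of o] :|:
  [set (gen_before i, (gen_after i * gen_before i)%g) | i in setU_of o].

Definition cambrian_congruence (n : nat) (o : orientation n) :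
    {set 'S_n * 'S_n} :=
  congruence_generated (@weak_le n) (contracted_pairs o).

Definition cambrian (n : nat) (o : orientation n) : finType :=
  {A : {set 'S_n} | A \in classes_of (cambrian_congruence o)}.

Definition cambrian_le (n : nat) (o : orientation n) : rel (cambrian o) :=
  fun A B => class_le (@weak_le n) (val A) (val B).

Definition avoider (n : nat) (o : orientation n) : finType :=
  {s : 'S_n | s \in avoiders o}.

Definition avoider_le (n : nat) (o : orientation n) : rel (avoider o) :=
  fun s t => weak_le (val s) (val t).

(* Main.v *)
(* A permutation is a biclosed set of inversions, and it avoids the two patterns
   exactly when this set S is "closed": for a < b < c and (a, c) in S one has
   (a, b) in S if b is in D and (b, c) in S if b is in U.

   Closed sets are stable under intersection, and the join of two of them is the
   transitive closure of the union.  The smallest closed set containing (a, c)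
   stays closed when (a, c) is removed, so the join-irreducibles are
   indexed by the pairs a < c.  Sending S to the pairs whose smallest closed set
   for the opposite orientation misses S is an anti-isomorphism onto the lattice
   of the opposite orientation, so the meet-irreducibles are as many.  For the
   left modular chain, put the point of abscissa i above or below the axis, on
   one of two opposite parabolas, according to whether i is in U or in D, and add
   the pairs by increasing slope of the segments which join them.

   The relation "containing the same largest closed set" is a lattice congruence.
   It is the generated one: if S is not closed, some adjacent descent c a has
   between its values an element b of U on its left or of D on its right, and the
   contraction of the corresponding cover follows from that of a generator by
   forcing in hexagons of the weak order. *)
Require Import Defs.
From mathcomp Require Import all_boot all_fingroup.
From mathcomp Require Import all_order all_algebra.
From mathcomp Require Import zify lra ring.

Set Implicit Arguments.
Unset Strict Implicit.
Unset Printing Implicit Defensive.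

(** * Closed sets of pairs *)

Section ClosedSets.

Variable n : nat.

Definition increasing_pairs : {set 'I_n * 'I_n} :=
  [set p : 'I_n * 'I_n | p.1 < p.2].

Definition transitive_set (S : {set 'I_n * 'I_n}) : Prop :=
  forall x y z, (x, y) \in S -> (y, z) \in S -> (x, z) \in S.

Definition cotransitive_set (S : {set 'I_n * 'I_n}) : Prop :=
  forall x y z : 'I_n, x < y -> y < z -> (x, z) \in S ->
  (x, y) \in S \/ (y, z) \in S.

Definition biclosed (S : {set 'I_n * 'I_n}) : Prop :=
  [/\ S \subset increasing_pairs, transitive_set S & cotransitive_set S].

Definition cambrian_closed (D : {set 'I_n}) (S : {set 'I_n * 'I_n}) : Prop :=
  [/\ S \subset increasing_pairs, transitive_set S &
      forall x y z : 'I_n, x < y -> y < z -> (x, z) \in S ->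
      if y \in D then (x, y) \in S else (y, z) \in S].

(* When L = D this is the smallest D-closed set containing (a, c); in general it
   is the inversion set of the join-irreducible permutation whose only descent
   is c a and which has L :&: ]a, c[ on the left of that descent. *)
Definition rect (L : {set 'I_n}) (a c : 'I_n) : {set 'I_n * 'I_n} :=
  [set p : 'I_n * 'I_n | [&& a <= p.1, p.1 < p.2, p.2 <= c,
              (p.1 == a) || (p.1 \notin L) & (p.2 == c) || (p.2 \in L)]].

(* Antitone; exchanges the sets closed for D and those closed for ~: D. *)
Definition avoiding (D : {set 'I_n}) (S : {set 'I_n * 'I_n}) :
    {set 'I_n * 'I_n} :=
  [set p : 'I_n * 'I_n in increasing_pairs | [disjoint rect D p.1 p.2 & S]].

(** For biclosed [S] this is the largest [D]-closed subset of [S]. *)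
Definition core (D : {set 'I_n}) (S : {set 'I_n * 'I_n}) :
    {set 'I_n * 'I_n} :=
  [set p : 'I_n * 'I_n in increasing_pairs | rect D p.1 p.2 \subset S].

Lemma rectP (L : {set 'I_n}) (a c x y : 'I_n) :
  reflect [/\ a <= x, x < y, y <= c, x = a \/ x \notin L & y = c \/ y \in L]
          ((x, y) \in rect L a c).
Proof.
rewrite inE /=; apply: (iffP and5P) => -[h1 h2 h3 h4 h5]; split=> //.
- by case/orP: h4 => [/eqP|]; [left | right].
- by case/orP: h5 => [/eqP|]; [left | right].
- by case: h4 => [->|->]; rewrite ?eqxx ?orbT.
- by case: h5 => [->|->]; rewrite ?eqxx ?orbT.
Qed.

Lemma in_increasing (S : {set 'I_n * 'I_n}) (x y : 'I_n) :
  S \subset increasing_pairs -> (x, y) \in S -> x < y.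
Proof. by move=> /subsetP sub /sub; rewrite inE. Qed.

Lemma cambrian_closed_biclosed D S : cambrian_closed D S -> biclosed S.
Proof.
case=> sub tr cl; split=> // x y z xy yz xz.
by have := cl _ _ _ xy yz xz; case: ifP; [left | right].
Qed.

Lemma mem_rect L (a c : 'I_n) : a < c -> (a, c) \in rect L a c.
Proof. by move=> ac; apply/rectP; split=> //; left. Qed.

Lemma rect_increasing L (a c : 'I_n) : rect L a c \subset increasing_pairs.
Proof. by apply/subsetP=> -[x y] /rectP[_ ? _ _ _]; rewrite inE. Qed.

(** Two pairs of the rectangle never compose, since the middle value would lie both in [L] and
    outside it; transitivity is thus vacuous. *)
Lemma rect_closed L (a c : 'I_n) : cambrian_closed L (rect L a c).
Proof.
split; first exact: rect_increasing.
- move=> x y z /rectP[ax xy yc hx hy] /rectP[ay yz zc hy' hz].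
  case: hy => [Ey|yL]; first by subst; lia.
  case: hy' => [Ey|]; [by subst; lia | by rewrite yL].
- move=> x y z xy yz /rectP[ax xz zc hx hz].
  by case: ifP => yL; apply/rectP; split=> //; rewrite ?yL; try lia; right.
Qed.

(** The closure conditions only ever ask for pairs narrower than one already present, hence never
    for the widest pair [(a, c)]. *)
Lemma rectD1_closed L (a c : 'I_n) :
  cambrian_closed L (rect L a c :\ (a, c)).
Proof.
have [sub tr cl] := rect_closed L a c.
split; first by apply: subset_trans (subsetDl _ _) sub.
- move=> x y z /setD1P[_ /rectP[ax xy yc hx hy]].
  case/setD1P=> _ /rectP[ay yz zc hy' hz].
  case: hy => [Ey|yL]; first by subst; lia.
  case: hy' => [Ey|]; [by subst; lia | by rewrite yL].
- move=> x y z xy yz /setD1P[_ xz]; have := cl _ _ _ xy yz xz.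
  case/rectP: xz => ax xz zc _ _.
  case: ifP => yL h; apply/setD1P; split=> //; apply/eqP=> -[*]; subst; lia.
Qed.

(** Starting from [(a, c)], first shrink the right end to [y], which is in [D], then the left end to
    [x], which is not. *)
Lemma rect_min D S (a c : 'I_n) :
  cambrian_closed D S -> (a, c) \in S -> rect D a c \subset S.
Proof.
case=> sub tr cl acS; apply/subsetP=> -[x y] /rectP[ax xy yc hx hy].
have ayS : (a, y) \in S.
  case: hy => [->//|yD].
  have [Ey|ne] := eqVneq y c; first by rewrite Ey.
  have ay : a < y by lia.
  have yc' : y < c by move: ne; rewrite -val_eqE /=; lia.
  by have := cl _ _ _ ay yc' acS; rewrite yD.
case: hx => [->//|xD].
have [Ex|ne] := eqVneq x a; first by rewrite Ex.
have ax' : a < x by move: ne; rewrite -val_eqE /=; lia.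
by have := cl _ _ _ ax' xy ayS; rewrite (negPf xD).
Qed.

Lemma rect_subset D (a c x y : 'I_n) :
  (x, y) \in rect D a c -> rect D x y \subset rect D a c.
Proof. by move=> /rect_min; apply; apply: rect_closed. Qed.

(** For transitivity, a pair of [S] in [rect D a c] that straddles [b] splits at [b] by
    cotransitivity, and its two pieces lie in [rect D a b] and [rect D b c]. The other condition
    holds because the rectangle of a pair contains the rectangles of its members. *)
Lemma avoiding_closed D S :
  cotransitive_set S -> cambrian_closed D (avoiding D S).
Proof.
move=> cotr; split.
- by apply/subsetP=> p; rewrite inE; case/andP.
- move=> a b c; rewrite !inE /= => /andP[ab dab] /andP[bc dbc].
  rewrite (ltn_trans ab bc) /=.
  rewrite disjoint_subset; apply/subsetP=> -[x y] xyR.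
  rewrite inE; apply/negP=> xyS; case/rectP: (xyR) => ax xy yc hx hy.
  have no p q : (p, q) \in rect D a b \/ (p, q) \in rect D b c ->
      (p, q) \in S -> False.
    by case=> h; rewrite ?(disjointFr dab h) ?(disjointFr dbc h).
  have [yb|by'] := leqP y b.
    apply: (no x y) => //; left; apply/rectP; split=> //.
    by case: hy => [Ey|]; [subst; lia | right].
  have [bx|xb] := leqP b x.
    apply: (no x y) => //; right; apply/rectP; split=> //.
    by case: hx => [Ex|]; [subst; lia | right].
  have [] := cotr _ _ _ xb by' xyS.
    by apply: no; left; apply/rectP; split=> //; left.
  by apply: no; right; apply/rectP; split=> //; left.
- move=> a b c ab bc; rewrite !inE /= => /andP[ac dac].
  rewrite ab bc; case: ifP => bD /=; apply: disjointWl dac;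
    apply: rect_subset; apply/rectP; rewrite ?bD; split=> //; try lia;
    by [right | left].
Qed.

(** Suppose that [(x, y)] in [rect D a c] is a narrowest pair missing from [S]. A pair [(u, v)] of
    [S] in [rect (~: D) x y] could be completed by [(x, u)] and [(v, y)], which are in [S] by
    minimality, to give [(x, y)] in [S]. So [(x, y)] is in [avoiding (~: D) S], against
    disjointness. *)
Lemma avoidingK_core D S :
  biclosed S -> avoiding D (avoiding (~: D) S) = core D S.
Proof.
case=> sub tr cotr; apply/setP=> -[a c]; rewrite !inE /=.
case: (ltnP a c) => //= ac; apply/idP/idP => [dis|].
  apply/subsetP=> -[x y].
  have [m] := ubnP (y - x); elim: m x y => // m IH x y lem xyR.
  apply/negPn/negP=> xyS.
  case/rectP: (xyR) => ax xy yc hx hy.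
  have := disjointFr dis xyR; rewrite !inE /= xy /= => /negP; apply.
  rewrite disjoint_subset; apply/subsetP=> -[u v] /rectP[xu uv vy hu hv].
  rewrite inE; apply/negP=> uvS.
  have sub_left (z : 'I_n) : x < z -> z < y -> z \in D -> (x, z) \in S.
    move=> xz zy zD; apply: IH; first by lia.
    by apply/rectP; split=> //; [lia | right].
  have sub_right (z : 'I_n) : x < z -> z < y -> z \notin D -> (z, y) \in S.
    move=> xz zy zD; apply: IH; first by lia.
    by apply/rectP; split=> //; [lia | right].
  have xvS : (x, v) \in S.
    case: hu => [<-//|]; rewrite inE negbK => uD.
    have [Eu|ne] := eqVneq u x; first by rewrite -Eu.
    by apply: tr uvS; apply: sub_left => //; move: ne; rewrite -?val_eqE /=; lia.
  case: hv => [Ev|]; first by rewrite -Ev xvS in xyS.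
  rewrite inE => vD; have [Ev|ne] := eqVneq v y; first by rewrite -Ev xvS in xyS.
  case/negP: xyS; apply: tr xvS _; apply: sub_right => //; first lia.
  by move: ne; rewrite -?val_eqE /=; lia.
move=> /subsetP subS; rewrite disjoint_subset; apply/subsetP=> -[x y] xyR.
rewrite inE; apply/negP; rewrite !inE /= => /andP[xy dis].
by have := disjointFr dis (mem_rect _ xy); rewrite subS.
Qed.

Lemma core_sub D S : core D S \subset S.
Proof.
apply/subsetP=> -[x y]; rewrite !inE /= => /andP[xy] /subsetP; apply.
exact: mem_rect.
Qed.

Lemma coreS D (S S' : {set 'I_n * 'I_n}) :
  S \subset S' -> core D S \subset core D S'.
Proof.
move=> SS'; apply/subsetP=> p; rewrite !inE => /andP[-> h].
exact: subset_trans SS'.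
Qed.

Lemma core_closed D S : biclosed S -> cambrian_closed D (core D S).
Proof.
move=> bS; rewrite -avoidingK_core //; apply: avoiding_closed.
have [_ _ cotr] := bS.
by case: (cambrian_closed_biclosed (avoiding_closed (~: D) cotr)).
Qed.

Lemma core_id D S : cambrian_closed D S -> core D S = S.
Proof.
move=> cS; apply/eqP; rewrite eqEsubset core_sub; apply/subsetP=> -[x y] xyS.
have [sub _ _] := cS; rewrite !inE /= (in_increasing sub) //=.
exact: rect_min.
Qed.

Lemma avoidingK D S :
  cambrian_closed D S -> avoiding D (avoiding (~: D) S) = S.
Proof.
move=> cS; rewrite avoidingK_core ?core_id //.
exact: cambrian_closed_biclosed cS.
Qed.

Lemma avoidingS D (S S' : {set 'I_n * 'I_n}) :
  S \subset S' -> avoiding D S' \subset avoiding D S.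
Proof.
move=> SS'; apply/subsetP=> p; rewrite !inE => /andP[-> h].
by apply: disjointWr h.
Qed.

(** Permutations with the same core thus also have the same image under [avoiding (~: D)]. *)
Lemma avoiding_core D S : biclosed S ->
  avoiding (~: D) (core D S) = avoiding (~: D) S.
Proof.
move=> bS; have [_ _ cotr] := bS.
by rewrite -avoidingK_core // -{2}(setCK D) avoidingK //; apply: avoiding_closed.
Qed.

Lemma avoiding_disjoint D S : [disjoint avoiding D S & S].
Proof.
rewrite disjoint_subset; apply/subsetP=> -[x y]; rewrite !inE /= => /andP[xy dis].
by rewrite (disjointFr dis) ?mem_rect.
Qed.

Lemma biclosedC S : biclosed S -> biclosed (increasing_pairs :\: S).
Proof.
case=> sub tr cotr; split; first exact: subsetDl.
- move=> x y z /setDP[+ xyS] /setDP[+ yzS]; rewrite !inE => xy yz.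
  rewrite (ltn_trans xy yz) andbT; apply/negP=> /(cotr _ _ _ xy yz).
  by case; apply/negP.
- move=> x y z xy yz; rewrite !inE /= xy yz !andbT => /andP[xzS _].
  case: (boolP ((x, y) \in S)) => xyS; last by left.
  by right; apply: contra xzS; apply: tr xyS.
Qed.

End ClosedSets.

(** * Lattices of closed sets *)

Section TransitiveClosure.

Variable n : nat.

(** Since [connect] is reflexive, the restriction to increasing pairs serves to discard the
    diagonal. *)
Definition trans_closure (S : {set 'I_n * 'I_n}) : {set 'I_n * 'I_n} :=
  [set p in increasing_pairs n | connect (fun i j => (i, j) \in S) p.1 p.2].

Lemma path_transitive_set (S : {set 'I_n * 'I_n}) a s :
  transitive_set S -> path (fun i j => (i, j) \in S) a s -> a != last a s ->
  (a, last a s) \in S.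
Proof.
move=> tr; elim: s a => [|b s IH] a /=; first by rewrite eqxx.
case/andP=> ab pa _; have [Eb|ne] := eqVneq b (last b s); first by rewrite -Eb.
exact: tr ab (IH _ pa ne).
Qed.

Lemma connect_increasing (S : {set 'I_n * 'I_n}) (a b : 'I_n) :
  S \subset increasing_pairs n ->
  connect (fun i j => (i, j) \in S) a b -> a <= b.
Proof.
move=> sub /connectP[s pa ->]; elim: s a pa => [|c s IH] a //= /andP[ac /IH].
by apply: leq_trans; apply: ltnW; apply: in_increasing ac.
Qed.

Lemma trans_closure_min (S S' : {set 'I_n * 'I_n}) :
  S \subset S' -> transitive_set S' -> trans_closure S \subset S'.
Proof.
move=> /subsetP sub tr; apply/subsetP=> -[a b]; rewrite !inE /= => /andP[ab].
case/connectP=> s pa Eb; rewrite Eb; apply: path_transitive_set => //.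
  by apply: sub_path pa => i j; apply: sub.
by rewrite -Eb neq_ltn ab.
Qed.

Lemma sub_trans_closure (S : {set 'I_n * 'I_n}) :
  S \subset increasing_pairs n -> S \subset trans_closure S.
Proof.
move=> sub; apply/subsetP=> -[a b] abS; rewrite !inE /= (in_increasing sub abS).
exact: connect1.
Qed.

(** Follow a path from [a] to [c]: it either visits [b], or has one step that jumps over [b], and
    that step is split by the closure condition of the set it comes from. *)
Lemma trans_closure_setU_closed D (S S' : {set 'I_n * 'I_n}) :
  cambrian_closed D S -> cambrian_closed D S' ->
  cambrian_closed D (trans_closure (S :|: S')).
Proof.
move=> [sub tr cl] [sub' tr' cl'].
have subU : S :|: S' \subset increasing_pairs n by rewrite subUset sub sub'.
have clU (x y z : 'I_n) : x < y -> y < z -> (x, z) \in S :|: S' ->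
    if y \in D then (x, y) \in S :|: S' else (y, z) \in S :|: S'.
  move=> xy yz; rewrite !inE => /orP[/(cl _ _ _ xy yz)|/(cl' _ _ _ xy yz)];
    by case: ifP => _ ->; rewrite ?orbT.
split.
- by apply/subsetP=> p; rewrite inE => /andP[].
- move=> x y z; rewrite !inE /= => /andP[xy cxy] /andP[yz cyz].
  by rewrite (ltn_trans xy yz) (connect_trans cxy cyz).
- move=> a b c ab bc; rewrite !inE /= ab bc /= => /andP[_].
  case/connectP=> s; elim: s a ab => [|x s IH] a ab /=.
    by move=> _ Ec; subst; lia.
  case/andP=> ax px Ec.
  have [bx|xb|Ex] := ltngtP b x.
  + have := clU _ _ _ ab bx ax; case: ifP => bD h; first exact: connect1.
    by apply: connect_trans (connect1 h) _; apply/connectP; exists s.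
  + have := IH _ xb px Ec; case: ifP => bD //.
    by apply: connect_trans; apply: connect1.
  + have -> : b = x by apply: val_inj.
    case: ifP => xD; first exact: connect1.
    by apply/connectP; exists s.
Qed.

End TransitiveClosure.

(** An isomorphism from [le] onto the [D]-closed sets ordered by inclusion. Both the quotient and
    the avoiders have one, so that trimness is proved once for all representations. *)
Definition cambrian_representation n (D : {set 'I_n}) (T : finType) (le : rel T)
    (I : T -> {set 'I_n * 'I_n}) : Prop :=
  [/\ injective I, forall x, cambrian_closed D (I x),
      forall S, cambrian_closed D S -> exists x, I x = S
    & forall x y, le x y = (I x \subset I y)].

Lemma dual_representation n (D : {set 'I_n}) (T : finType) (le : rel T) I :
  cambrian_representation D le I ->
  cambrian_representation (~: D) (fun x y => le y x)
    (fun x => avoiding (~: D) (I x)).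
Proof.
case=> inj cl onto leE.
have cotr x : cotransitive_set (I x).
  by case: (cambrian_closed_biclosed (cl x)).
split.
- by move=> x y E; apply: inj; rewrite -(avoidingK (cl x)) E avoidingK.
- by move=> x; apply: avoiding_closed.
- move=> S cS; have [_ _ cotrS] := cambrian_closed_biclosed cS.
  have [x Ix] := onto _ (avoiding_closed D cotrS).
  by exists x; rewrite Ix -{2}(setCK D) avoidingK.
- move=> x y; rewrite leE; apply/idP/idP; first exact: avoidingS.
  by move/(avoidingS D); rewrite !avoidingK.
Qed.

(** * Joins, meets, join-irreducibles and left modular elements *)

Section Representation.

Variables (n : nat) (D : {set 'I_n}) (T : finType) (le : rel T).
Variable I : T -> {set 'I_n * 'I_n}.
Hypothesis repr : cambrian_representation D le I.

Let I_inj : injective I. Proof. by case: repr. Qed.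
Let I_closed x : cambrian_closed D (I x). Proof. by case: repr. Qed.
Let I_onto S : cambrian_closed D S -> exists x, I x = S.
Proof. by case: repr => _ _ + _; apply. Qed.
Let leE x y : le x y = (I x \subset I y). Proof. by case: repr. Qed.
Let I_sub x : I x \subset increasing_pairs n. Proof. by case: (I_closed x). Qed.
Let I_trans x : transitive_set (I x). Proof. by case: (I_closed x). Qed.

Lemma cambrian_closedI S S' :
  cambrian_closed D S -> cambrian_closed D S' -> cambrian_closed D (S :&: S').
Proof.
move=> [sub tr cl] [sub' tr' cl']; split.
- exact: subset_trans (subsetIl _ _) sub.
- move=> x y z /setIP[h1 h2] /setIP[h3 h4].
  by rewrite inE (tr _ _ _ h1 h3) (tr' _ _ _ h2 h4).
- move=> x y z xy yz /setIP[/(cl _ _ _ xy yz) + /(cl' _ _ _ xy yz)].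
  by case: ifP => _ h h'; rewrite inE h h'.
Qed.

Lemma representation_join_exists x y :
  exists2 z, is_join le x y z & I z = trans_closure (I x :|: I y).
Proof.
have [z Iz] := I_onto (trans_closure_setU_closed (I_closed x) (I_closed y)).
exists z => //; have subU : I x :|: I y \subset I z.
  by rewrite Iz sub_trans_closure // subUset !I_sub.
apply/and3P; split.
- by rewrite leE; apply: subset_trans (subsetUl _ _) subU.
- by rewrite leE; apply: subset_trans (subsetUr _ _) subU.
- apply/forallP=> u; apply/implyP; rewrite !leE -subUset Iz => /trans_closure_min.
  by apply; apply: I_trans.
Qed.

Lemma representation_meetP x y z : I z = I x :&: I y -> is_meet le x y z.
Proof.
move=> Iz; apply/and3P; rewrite !leE Iz subsetIl subsetIr; split=> //.
by apply/forallP=> u; rewrite !leE Iz subsetI; apply: implybb.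
Qed.

Lemma representation_meet x y z : is_meet le x y z -> I z = I x :&: I y.
Proof.
have [u Iu] := I_onto (cambrian_closedI (I_closed x) (I_closed y)).
case/and3P=> zx zy /forallP/(_ u); rewrite !leE Iu subsetIl subsetIr /= => h.
by apply/eqP; rewrite eqEsubset h subsetI -!leE zx zy.
Qed.

Lemma representation_lattice : is_lattice le.
Proof.
split; first split.
- by move=> x; rewrite leE.
- by move=> x y; rewrite !leE -eqEsubset => /eqP/I_inj.
- by move=> y x z; rewrite !leE; apply: subset_trans.
move=> x y; split; first by have [z] := representation_join_exists x y; exists z.
have [u Iu] := I_onto (cambrian_closedI (I_closed x) (I_closed y)).
by exists u; apply: representation_meetP.
Qed.

(** By minimality of the rectangle, everything strictly below [x] misses [(a, c)], hence lies below
    the closed set [rect D a c :\ (a, c)], and so do the joins of such elements. *)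
Lemma rect_join_irreducible (a c : 'I_n) x :
  a < c -> I x = rect D a c -> join_irreducible le x.
Proof.
move=> ac Ix; apply/andP; split.
  have [z Iz] : exists z, I z = set0.
    by apply: I_onto; split=> [|x' y z|x' y z _ _]; rewrite ?sub0set ?inE.
  apply/existsP; exists z; rewrite leE Iz subset0; apply/set0Pn.
  by exists (a, c); rewrite Ix mem_rect.
apply/'forall_forallP => y z; apply/implyP=> /and3P[yx zx min].
apply/negPn/negP; rewrite negb_or => /andP[xy xz].
have proper u : le u x -> x != u -> I u \subset rect D a c :\ (a, c).
  rewrite leE => ux xu; rewrite subsetD1 -Ix ux /=; apply/negP=> acu.
  case/eqP: xu; apply: I_inj; apply/eqP; rewrite eqEsubset ux andbT Ix.
  exact: rect_min.
have [u Iu] := I_onto (rectD1_closed D a c).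
have := forallP min u; rewrite !leE Iu (proper y) // (proper z) //= Ix.
by move/subsetP/(_ _ (mem_rect _ ac)); rewrite !inE eqxx.
Qed.

(** Take [y] strictly below [x] with as many pairs as possible, and [(a, c)] in [I x] but not in
    [I y]. Then [x] is the join of [y] and the element with rectangle [rect D a c], so it equals the
    latter. *)
Lemma join_irreducible_rect x :
  join_irreducible le x ->
  exists2 p, p \in increasing_pairs n & I x = rect D p.1 p.2.
Proof.
case/andP=> /existsP[y0 nxy0] /forallP irr.
have [z Iz] : exists z, I z = set0.
  by apply: I_onto; split=> [|x' y z|x' y z _ _]; rewrite ?sub0set ?inE.
have zx : I z \proper I x.
  rewrite Iz properE sub0set subset0 /=; apply: contra nxy0 => /eqP Ix.
  by rewrite leE Ix sub0set.
have [y yx max] :=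
  @arg_maxnP _ z (fun y => I y \proper I x) (fun y => #|I y|) zx.
have /properP[yx' [[a c] acx acy]] := yx.
have ac : a < c by apply: in_increasing acx.
have [j Ij] := I_onto (rect_closed D a c).
have jx : I j \subset I x by rewrite Ij rect_min.
have : is_join le y j x.
  apply/and3P; rewrite !leE; split=> //; apply/forallP=> u; apply/implyP.
  rewrite !leE => /andP[yu ju].
  have [w Iw] := I_onto (cambrian_closedI (I_closed u) (I_closed x)).
  have [//|nux] := boolP (I x \subset I u).
  (* The meet [w] of [u] and [x] would be strictly below [x], yet strictly larger than [y] since it
     contains [(a, c)]. *)
  have wx : I w \proper I x.
    by rewrite Iw properE subsetIr subsetI subxx andbT.
  have := max _ wx; rewrite /= leqNgt => /negP[]; apply: proper_card.
  rewrite Iw properE subsetI yu yx' /=; apply/negP=> /subsetP/(_ (a, c)).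
  rewrite inE acx (subsetP ju) ?Ij ?mem_rect // => /(_ isT); exact/negP.
have /forallP/(_ j)/implyP h := irr y.
move/h => /orP[/eqP E|/eqP E].
  by rewrite E properxx in yx.
by exists (a, c); rewrite ?inE // E Ij.
Qed.

Lemma rect_inj (a c a' c' : 'I_n) : a < c -> a' < c' ->
  rect D a c = rect D a' c' -> (a, c) = (a', c').
Proof.
move=> ac ac' E.
have := mem_rect D ac; rewrite E => /rectP[h1 _ h2 _ _].
have := mem_rect D ac'; rewrite -E => /rectP[h3 _ h4 _ _].
by congr (_, _); apply: val_inj => /=; lia.
Qed.

Lemma card_join_irreducible :
  #|[set x | join_irreducible le x]| = #|increasing_pairs n|.
Proof.
have [f If] : exists f : 'I_n * 'I_n -> T, forall p, I (f p) = rect D p.1 p.2.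
  apply: (@fin_all_exists _ _ (fun p z => I z = rect D p.1 p.2)) => p.
  by apply: I_onto; apply: rect_closed.
rewrite -(@card_in_imset _ _ f (mem (increasing_pairs n))); last first.
  move=> [a c] [a' c']; rewrite !inE /= => ac ac' E.
  by apply: rect_inj => //; rewrite -(If (a, c)) -(If (a', c')) E.
apply: eq_card => x; rewrite inE; apply/idP/imsetP.
  case/join_irreducible_rect=> p pn Ix; exists p => //.
  by apply: I_inj; rewrite If.
case=> -[a c]; rewrite !inE => ac ->.
by apply: rect_join_irreducible (If _).
Qed.

(* A step (p, q) of X from a to c which is not in Z has q < c outside of D, or
   a < p in D; then it extends to (p, c), or to (a, q), and the path shrinks. *)
Lemma path_shortcut (X Y Z W : {set 'I_n * 'I_n}) (a : 'I_n) s :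
    cambrian_closed D X -> cambrian_closed D Y -> cambrian_closed D Z ->
    transitive_set W -> Y \subset W -> X :&: Z \subset W ->
    (forall p q r : 'I_n, p < q -> q < r -> q \notin D ->
       (p, q) \in X -> (p, r) \in X) ->
    (forall p q r : 'I_n, p < q -> q < r -> q \in D ->
       (q, r) \in X -> (p, r) \in X) ->
  path (fun i j => (i, j) \in Y :|: X) a s ->
  (a, last a s) \in Z -> (a, last a s) \in W.
Proof.
move=> cX cY cZ trW YW XZW extR extL.
have [subX _ _] := cX; have [subY _ _] := cY; have [subZ _ _] := cZ.
have subU : Y :|: X \subset increasing_pairs n by rewrite subUset subX subY.
set e := fun i j : 'I_n => _.
pose e' := fun i j : 'I_n => (i, j) \in Y :|: (X :&: Z).
have split_bad b t : ~~ path e' b t ->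
    exists t1 q t2, t = t1 ++ q :: t2 /\ ~~ e' (last b t1) q.
  elim: t b => [|c t IH] b //=; rewrite negb_and.
    case/orP=> [h|/IH[t1 [q [t2 [-> h]]]]].
    by exists [::], c, t.
  by exists (c :: t1), q, t2.
have [m] := ubnP (size s); elim: m a s => // m IH a s lem pa acZ.
have ac := in_increasing subZ acZ.
have [good|/split_bad[s1 [q [s2 [Es bad]]]]] := boolP (path e' a s).
  apply: path_transitive_set trW _ _; last by rewrite neq_ltn ac.
  apply: sub_path good => i j; apply/subsetP.
  by rewrite subUset YW.
move: pa lem acZ ac; rewrite Es last_cat cat_path size_cat /=.
set p := last a s1; set c := last q s2 => /and3P[p1 pq p2] lem acZ ac.
have pqX : (p, q) \in X /\ (p, q) \notin Z.
  move: bad pq; rewrite /e' /e !inE negb_or => /andP[/negPf -> /=].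
  by move=> + pq; rewrite pq.
case: pqX => pqX pqZ.
have ltpq := in_increasing subX pqX.
have leap : a <= p.
  by apply: connect_increasing subU _; apply/connectP; exists s1.
have leqc : q <= c.
  by apply: connect_increasing subU _; apply/connectP; exists s2.
have [/andP[ltqc qD]|right_ok] := boolP ((q < c) && (q \notin D)).
  have := IH a (s1 ++ [:: c]); rewrite last_cat cat_path size_cat /= p1 -/p.
  apply=> //.
    have s2_gt0 : 0 < size s2 by move: ltqc; rewrite /c; case: (s2); rewrite ?ltnn.
    by move: lem s2_gt0; clear; lia.
  by rewrite andbT /e inE (extR _ _ _ ltpq ltqc qD pqX) orbT.
have [/andP[ltap pD]|left_ok] := boolP ((a < p) && (p \in D)).
  apply: (IH a (q :: s2)) => //=.
    have s1_gt0 : 0 < size s1 by move: ltap; rewrite /p; case: (s1); rewrite ?ltnn.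
    by move: lem s1_gt0; clear; lia.
  by rewrite p2 andbT /e inE (extL _ _ _ ltap ltpq pD pqX) orbT.
(* If neither extension is available, then [(p, q)] is in [rect D a c], which is contained in
   [Z]. *)
case/negP: pqZ; apply: (subsetP (rect_min cZ acZ)); apply/rectP; split=> //.
  move: left_ok; rewrite negb_and -leqNgt => /orP[h|]; last by right.
  by left; apply/val_inj/eqP; rewrite /= eqn_leq h.
move: right_ok; rewrite negb_and negbK -leqNgt => /orP[h|]; last by right.
by left; apply/val_inj/eqP; rewrite /= eqn_leq leqc.
Qed.

(** The point is that (y \/ x) /\ z lies below y \/ (x /\ z). A pair on the left is joined by a path
    of pairs of [y] and [x], and belongs to [z]; by [path_shortcut] it belongs to every upper bound
    of [y] and x /\ z. *)
Lemma left_modular_criterion x :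
    (forall p q r : 'I_n, p < q -> q < r -> q \notin D ->
       (p, q) \in I x -> (p, r) \in I x) ->
    (forall p q r : 'I_n, p < q -> q < r -> q \in D ->
       (q, r) \in I x -> (p, r) \in I x) ->
  left_modular le x.
Proof.
move=> extR extL y z; rewrite leE => yz _ yx xz jyx /representation_meet Ixz.
have [w Iw] := I_onto (cambrian_closedI (I_closed yx) (I_closed z)).
have [t jt It] := representation_join_exists y x.
have {jt} yxt : I yx \subset I t.
  have [_ _ /forallP/(_ t)] := and3P jyx; rewrite !leE => /implyP; apply.
  by have [] := and3P jt; rewrite !leE => -> ->.
have [yyx xyx _] := and3P jyx; rewrite !leE in yyx xyx.
exists w; split; first exact: representation_meetP.
apply/and3P; rewrite !leE Ixz Iw !subsetI yyx yz subsetIr /=; split=> //.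
  by rewrite andbT; apply: subset_trans (subsetIl _ _) xyx.
apply/forallP=> u; apply/implyP; rewrite !leE Iw Ixz => /andP[yu xzu].
apply/subsetP=> -[a c] /setIP[/(subsetP yxt)]; rewrite It inE /= => /andP[ac].
case/connectP=> s pa Ec; rewrite {c}Ec in ac * => acz.
have shortcut :=
  path_shortcut (I_closed x) (I_closed y) (I_closed z) (@I_trans u).
exact: shortcut.
Qed.

End Representation.

(** * The left modular chain *)

Section Slopes.
Import Order.TTheory GRing.Theory Num.Theory.
Local Open Scope ring_scope.

Variables (n : nat) (D : {set 'I_n}).

Definition height (i : 'I_n) : rat :=
  let f := i%:R * (n%:R - i%:R) in if i \in D then - f else f.

Definition slope (p : 'I_n * 'I_n) : rat :=
  (height p.2 - height p.1) / (p.2%:R - p.1%:R).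

(** It puts the slope of a segment strictly between the slopes of its two pieces. *)
Lemma mediant_lt (A B u v : rat) : 0 < u -> 0 < v -> B / v < A / u ->
  B / v < (A + B) / (u + v) /\ (A + B) / (u + v) < A / u.
Proof.
move=> u0 v0; have uv0 : 0 < u + v by lra.
rewrite ltr_pdivrMr // mulrAC ltr_pdivlMr // => h; split.
  by rewrite ltr_pdivrMr // mulrAC ltr_pdivlMr //; lra.
by rewrite ltr_pdivrMr // mulrAC ltr_pdivlMr //; lra.
Qed.

Lemma parabola_concave (m x y z : rat) : 0 <= x -> x < y -> y < z -> z <= m ->
  forall hx hz, hx <= x * (m - x) -> hz <= z * (m - z) ->
  (hz - y * (m - y)) * (y - x) < (y * (m - y) - hx) * (z - y).
Proof.
move=> x0 xy yz zm hx hz hxle hzle.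
(* The difference of the two sides of the goal is exactly the sum of the next three products. *)
have : 0 <= (x * (m - x) - hx) * (z - y) by apply: mulr_ge0; lra.
have : 0 <= (z * (m - z) - hz) * (y - x) by apply: mulr_ge0; lra.
have : 0 < (z - y) * (y - x) * (z - x) by rewrite !mulr_gt0; lra.
nra.
Qed.

Lemma height_abs i : `|height i| <= i%:R * (n%:R - i%:R).
Proof.
have f0 : 0 <= i%:R * (n%:R - i%:R) :> rat.
  by rewrite mulr_ge0 ?subr_ge0 ?ler_nat // ltnW.
by rewrite /height; case: ifP => _; rewrite ?normrN ger0_norm.
Qed.

(** All points lie between the two parabolas and [y] is on one of them, so by strict convexity it is
    strictly below the segment from [x] to [z] if it is in [D], and strictly above otherwise. *)
Lemma slope_mid (x y z : 'I_n) : (x < y)%N -> (y < z)%N ->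
  if y \in D then slope (x, y) < slope (x, z) /\ slope (x, z) < slope (y, z)
  else slope (y, z) < slope (x, z) /\ slope (x, z) < slope (x, y).
Proof.
move=> xy yz.
have xy' : x%:R < y%:R :> rat by rewrite ltr_nat.
have yz' : y%:R < z%:R :> rat by rewrite ltr_nat.
have x0 : 0 <= x%:R :> rat by rewrite ler0n.
have zn : z%:R <= n%:R :> rat by rewrite ler_nat ltnW.
have u0 : 0 < y%:R - x%:R :> rat by lra.
have v0 : 0 < z%:R - y%:R :> rat by lra.
have Exz : (height z - height x) / (z%:R - x%:R) =
    ((height y - height x) + (height z - height y)) /
    ((y%:R - x%:R) + (z%:R - y%:R)) by congr (_ / _); ring.
have Exz' : (height z - height x) / (z%:R - x%:R) =
    ((height z - height y) + (height y - height x)) /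
    ((z%:R - y%:R) + (y%:R - x%:R)) by congr (_ / _); ring.
have := height_abs x; have := height_abs z.
rewrite !ler_norml => /andP[hz1 hz2] /andP[hx1 hx2].
case: ifP => yD; rewrite /slope /=.
  rewrite Exz'; apply: mediant_lt => //.
  rewrite ltr_pdivrMr // mulrAC ltr_pdivlMr //.
  (* Reflection in the axis brings the lower parabola to the upper one. *)
  have concave := @parabola_concave n%:R _ _ _ x0 xy' yz' zn
    (- height x) (- height z).
  have -> : height y = - (y%:R * (n%:R - y%:R)) by rewrite /height yD.
  have := concave ltac:(lra) ltac:(lra); lra.
rewrite Exz; apply: mediant_lt => //.
rewrite ltr_pdivrMr // mulrAC ltr_pdivlMr //.
have -> : height y = y%:R * (n%:R - y%:R) by rewrite /height yD.
exact: parabola_concave.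
Qed.

End Slopes.

(** * Initial segments of the slope order *)

Section SlopeChain.
Import Order.TTheory.

Variables (n : nat) (D : {set 'I_n}).

Let slope_le : rel ('I_n * 'I_n) := fun p q => (slope D p <= slope D q)%R.

(** Pairs of equal slope are ordered arbitrarily by the sort; this is harmless because [slope_mid]
    gives strict inequalities. *)
Definition slope_prefix (k : nat) : {set 'I_n * 'I_n} :=
  [set p in take k (sort slope_le (enum (increasing_pairs n)))].

Lemma mem_slope_sort (p : 'I_n * 'I_n) :
  (p \in sort slope_le (enum (increasing_pairs n))) = (p.1 < p.2).
Proof. by rewrite mem_sort mem_enum inE. Qed.

Lemma slope_prefix_sub k : slope_prefix k \subset increasing_pairs n.
Proof.
by apply/subsetP=> p; rewrite !inE => /mem_take; rewrite mem_slope_sort.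
Qed.

Lemma slope_prefix_down k (p q : 'I_n * 'I_n) :
  p \in slope_prefix k -> q.1 < q.2 -> (slope D q < slope D p)%R ->
  q \in slope_prefix k.
Proof.
rewrite -mem_slope_sort !inE => pk.
rewrite -{1}(cat_take_drop k (sort _ _)) mem_cat => /orP[//|qd].
have tr : transitive slope_le by move=> y x z; apply: le_trans.
have : sorted slope_le (sort slope_le (enum (increasing_pairs n))).
  by apply: sort_sorted => x y; apply: le_total.
rewrite sorted_pairwise // -(cat_take_drop k (sort _ _)) pairwise_cat.
case/andP=> /allrelP/(_ _ _ pk qd) + _.
by rewrite /slope_le leNgt => /negPf ->.
Qed.

Lemma card_slope_prefix k :
  k <= #|increasing_pairs n| -> #|slope_prefix k| = k.
Proof.
move=> kN; rewrite cardsE.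
have /card_uniqP-> : uniq (take k (sort slope_le (enum (increasing_pairs n)))).
  by apply: take_uniq; rewrite sort_uniq enum_uniq.
by rewrite size_take size_sort -cardE; case: ltngtP kN.
Qed.

Lemma slope_prefixS k l : k <= l -> slope_prefix k \subset slope_prefix l.
Proof.
by move=> kl; apply/subsetP=> p; rewrite !inE -{1}(minn_idPl kl) take_min => /mem_take.
Qed.

(** The slope of [(x, z)] is below that of its steeper piece, which gives transitivity, and above
    that of the other piece, which is [(x, y)] for [y] in [D] and [(y, z)] otherwise. *)
Lemma slope_prefix_closed k : cambrian_closed D (slope_prefix k).
Proof.
split; first exact: slope_prefix_sub.
- move=> x y z xyS yzS.
  have xy := in_increasing (slope_prefix_sub k) xyS.
  have yz := in_increasing (slope_prefix_sub k) yzS.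
  have := slope_mid D xy yz; case: ifP => _ [h1 h2].
    by apply: slope_prefix_down yzS _ h2; apply: ltn_trans yz.
  by apply: slope_prefix_down xyS _ h2; apply: ltn_trans yz.
- move=> x y z xy yz xzS; have := slope_mid D xy yz.
  by case: ifP => _ [h1 h2]; apply: slope_prefix_down xzS _ h1.
Qed.

(** This and the next lemma are the hypotheses of [left_modular_criterion]: the given piece is the
    steeper one. *)
Lemma slope_prefix_extendr k (x y z : 'I_n) : x < y -> y < z -> y \notin D ->
  (x, y) \in slope_prefix k -> (x, z) \in slope_prefix k.
Proof.
move=> xy yz yD xyS; have := slope_mid D xy yz.
rewrite (negPf yD) => -[_ h2].
by apply: slope_prefix_down xyS _ h2; apply: ltn_trans yz.
Qed.

Lemma slope_prefix_extendl k (x y z : 'I_n) : x < y -> y < z -> y \in D ->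
  (y, z) \in slope_prefix k -> (x, z) \in slope_prefix k.
Proof.
move=> xy yz yD yzS; have := slope_mid D xy yz.
rewrite yD => -[_ h2].
by apply: slope_prefix_down yzS _ h2; apply: ltn_trans yz.
Qed.

Variables (T : finType) (le : rel T) (I : T -> {set 'I_n * 'I_n}).

(** On a chain the cardinal of [I x] determines [x]. The bound makes the chain of prefixes
    maximal. *)
Lemma card_chain (C : {set T}) : cambrian_representation D le I ->
  is_chain le C -> #|C| <= #|increasing_pairs n|.+1.
Proof.
case=> inj cl _ leE /'forall_in_'forall_in_orP chain.
have sub x : I x \subset increasing_pairs n by case: (cl x).
pose f x : 'I_#|increasing_pairs n|.+1 := inord #|I x|.
have f_inj : {in C &, injective f}.
  move=> x y xC yC /(congr1 val); rewrite /f /=.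
  rewrite !inordK ?ltnS ?subset_leq_card // => E.
  apply: inj; apply/eqP.
  by case: (chain x xC y yC); rewrite leE => h; [|rewrite eq_sym];
     rewrite eqEcard h E leqnn.
by rewrite -(card_in_imset f_inj) -[X in _ <= X]card_ord max_card.
Qed.

Lemma representation_trim : cambrian_representation D le I -> trim le.
Proof.
move=> repr; have [inj cl onto leE] := repr.
split; first exact: representation_lattice repr.
exists #|increasing_pairs n|; split.
- have [g Ig] : exists g : 'I_#|increasing_pairs n|.+1 -> T,
      forall k, I (g k) = slope_prefix k.
    apply: (@fin_all_exists _ _
      (fun (k : 'I_#|increasing_pairs n|.+1) z => I z = slope_prefix k)) => k.
    by apply: onto; apply: slope_prefix_closed.
  have g_inj : injective g.
    move=> k l E; apply: val_inj; rewrite /= -[LHS]card_slope_prefix -1?ltnS //.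
    by rewrite -Ig E Ig card_slope_prefix // -ltnS.
  exists [set g k | k in 'I_#|increasing_pairs n|.+1].
  have cardC : #|[set g k | k in 'I_#|increasing_pairs n|.+1]| =
      #|increasing_pairs n|.+1.
    by rewrite card_imset // card_ord.
  split=> //.
    apply/maxsetP; split; last first.
      move=> B chainB CB; apply/eqP; rewrite eq_sym eqEcard CB cardC.
      exact: card_chain chainB.
    apply/'forall_in_'forall_in_orP => _ /imsetP[k _ ->] _ /imsetP[l _ ->].
    by rewrite !leE !Ig; case: (leqP k l) => [|/ltnW] /slope_prefixS; [left|right].
  move=> _ /imsetP[k _ ->]; apply: (left_modular_criterion repr); rewrite Ig.
    exact: slope_prefix_extendr.
  exact: slope_prefix_extendl.
- exact: card_join_irreducible repr.
(* The join-irreducibles of the reversed order are, by conversion, the meet-irreducibles of [le]. *)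
- exact: card_join_irreducible (dual_representation repr).
Qed.

End SlopeChain.

(** * Permutations and their inversion sets *)

Section Permutations.

Variable n : nat.

Lemma mem_inversions (s : 'S_n) i j :
  ((i, j) \in inversions s) = (i < j) && ((s^-1)%g j < (s^-1)%g i).
Proof. by rewrite inE. Qed.

Lemma inversions_biclosed (s : 'S_n) : biclosed (inversions s).
Proof.
split.
- by apply/subsetP=> -[i j]; rewrite mem_inversions inE => /andP[].
- by move=> x y z; rewrite !mem_inversions; lia.
- move=> x y z xy yz; rewrite !mem_inversions xy yz (ltn_trans xy yz) /=.
  by case: (ltnP ((s^-1)%g y) ((s^-1)%g x)) => h; [left | right; lia].
Qed.

Lemma monotone_perm_ge (r : 'S_n) :
  (forall i j : 'I_n, i < j -> r i < r j) -> forall i : 'I_n, i <= r i.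
Proof.
move=> mono i; have [m] := ubnP i; elim: m i => // m IH i lem.
by rewrite leqNgt; apply/negP=> ri; have := IH (r i); have := mono _ _ ri; lia.
Qed.

(** If the inversions agree, then sending the position of a letter in [s] to its position in [t] is
    increasing, so no letter moves to the left; by symmetry none moves at all. *)
Lemma inversions_inj : injective (@inversions n).
Proof.
suff main (s t : 'S_n) i : inversions s = inversions t -> (s^-1)%g i <= (t^-1)%g i.
  move=> s t E; apply: invg_inj; apply/permP=> i; apply: val_inj; apply/eqP.
  by rewrite eqn_leq !main.
move=> E; have -> : (t^-1 i = (s * t^-1) (s^-1 i))%g by rewrite permM permKV.
apply: monotone_perm_ge => j k jk; rewrite !permM.
have := congr1 (fun S : {set 'I_n * 'I_n} => (s j, s k) \in S) E.
have := congr1 (fun S : {set 'I_n * 'I_n} => (s k, s j) \in S) E.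
rewrite !mem_inversions !permK.
have ne : s j != s k by rewrite (inj_eq perm_inj) neq_ltn jk.
have ne' : (t^-1 (s j) != t^-1 (s k))%g by rewrite (inj_eq perm_inj).
move: ne ne'; rewrite -!val_eqE /=; lia.
Qed.

(** The left-to-right order of the letters in a word with inversion set [S]. *)
Definition precedes (S : {set 'I_n * 'I_n}) (x y : 'I_n) : bool :=
  (x < y) && ((x, y) \notin S) || (y < x) && ((y, x) \in S).

Lemma precedes_trans (S : {set 'I_n * 'I_n}) :
  biclosed S -> transitive (precedes S).
Proof.
case=> sub tr cotr y x z; rewrite /precedes.
case/orP=> /andP[xy xyS]; case/orP=> /andP[yz yzS].
- rewrite (ltn_trans xy yz) /=; apply/orP; left; apply/negP=> xzS.
  by case: (cotr _ _ _ xy yz xzS) => h; [rewrite h in xyS | rewrite h in yzS].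
- case: (ltngtP x z) => xz /=.
  + rewrite orbF; apply: contra xyS => h; exact: tr h yzS.
  + by case: (cotr _ _ _ xz xy yzS) => // h; rewrite h in xyS.
  + by move: xyS; rewrite (val_inj xz) yzS.
- case: (ltngtP x z) => xz /=.
  + rewrite orbF; apply: contra yzS => h; exact: tr xyS h.
  + by case: (cotr _ _ _ yz xz xyS) => // h; rewrite h in yzS.
  + by move: yzS; rewrite -(val_inj xz) xyS.
- by rewrite (ltn_trans yz xy) (tr _ _ _ yzS xyS) orbT.
Qed.

Lemma precedes_irr S : irreflexive (precedes S).
Proof. by move=> x; rewrite /precedes ltnn. Qed.

(** [precedes S] is a strict total order; the position of a letter is the number of letters that
    precede it. *)
Lemma biclosed_inversions S : biclosed S -> exists s : 'S_n, inversions s = S.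
Proof.
move=> bS; have [sub _ _] := bS.
have pos_lt y : #|[set x | precedes S x y]| < n.
  rewrite -[X in _ < X]card_ord -[X in _ < X]cardsT; apply: proper_card.
  by apply/properP; split=> //; exists y; rewrite ?inE ?precedes_irr.
pose pos y := Ordinal (pos_lt y).
have pos_mono x y : precedes S x y -> pos x < pos y.
  move=> xy; apply: proper_card; apply/properP; split.
    by apply/subsetP=> z; rewrite !inE => /precedes_trans; apply.
  by exists x; rewrite !inE ?precedes_irr.
have total (x y : 'I_n) : x < y -> (precedes S x y = ((x, y) \notin S)) *
                          (precedes S y x = ((x, y) \in S)).
  by move=> xy; rewrite /precedes xy ltnNge (ltnW xy) /= orbF.
have pos_inj : injective pos.
  move=> x y E; apply: val_inj; case: (ltngtP x y) => // h;
    have := pos_mono x y; have := pos_mono y x; rewrite E ltnn !(total _ _ h);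
    by case: (_ \in S) => a b; first [have := a isT | have := b isT].
exists (perm pos_inj)^-1%g; apply/setP=> -[x y]; rewrite mem_inversions invgK !permE.
case: (ltnP x y) => [xy|yx] /=.
  have := pos_mono x y; have := pos_mono y x; rewrite !(total _ _ xy).
  by case: (_ \in S) => /= a b; [exact: a | apply/negbTE; rewrite -leqNgt ltnW ?b].
by apply/esym/negbTE/negP=> /(in_increasing sub); rewrite ltnNge yx.
Qed.

(** The inversions of the word sorted by [f], letters of equal rank being in increasing order. *)
Definition rank_inversions (f : 'I_n -> nat) : {set 'I_n * 'I_n} :=
  [set p : 'I_n * 'I_n | (p.1 < p.2) && (f p.2 < f p.1)].

Lemma rank_inversions_biclosed f : biclosed (rank_inversions f).
Proof.
split.
- by apply/subsetP=> -[i j]; rewrite !inE => /andP[].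
- by move=> x y z; rewrite !inE /=; lia.
- move=> x y z xy yz; rewrite !inE /= xy yz (ltn_trans xy yz) /=.
  by case: (ltnP (f y) (f x)) => h; [left | right; lia].
Qed.

Variable o : orientation n.

Lemma setD_of_interior (i : 'I_n) : i \in setD_of o -> 0 < i < n.-1.
Proof. by case/imsetP=> -[j jP] _ ->. Qed.

Lemma setU_of_interior (i : 'I_n) : i \in setU_of o -> 0 < i < n.-1.
Proof. by case/imsetP=> -[j jP] _ ->. Qed.

Lemma mem_setU_of (i : 'I_n) :
  0 < i < n.-1 -> (i \in setU_of o) = (i \notin setD_of o).
Proof.
move=> iP; have -> : i = val (exist _ i iP : interior n) by [].
by rewrite !(mem_imset _ _ val_inj) !inE.
Qed.

(** When [(a, c)] is an inversion, a failure at [b] in [D] reads c a b, and a failure at [b] outside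
    [D] reads b c a. Lying strictly between two values, [b] is interior. *)
Lemma avoiders_closed s :
  (s \in avoiders o) <-> cambrian_closed (setD_of o) (inversions s).
Proof.
have [sub tr cotr] := inversions_biclosed s.
rewrite inE; split=> [/andP[no231 no312]|[_ _ cl]].
- split=> // a b c ab bc acS.
  have bint : 0 < b < n.-1 by have := ltn_ord c; lia.
  case: ifP => bD; apply/negPn/negP=> bad.
  + case/existsP: no312; exists ((s^-1)%g c); apply/existsP; exists ((s^-1)%g a).
    apply/existsP; exists ((s^-1)%g b); rewrite !permKV bD ab bc.
    move: acS bad; rewrite !mem_inversions ab (ltn_trans ab bc) /= => -> /=.
    have : (s^-1 a != s^-1 b)%g by rewrite (inj_eq perm_inj) neq_ltn ab.
    rewrite -val_eqE /=; lia.
  + case/existsP: no231; exists ((s^-1)%g b); apply/existsP; exists ((s^-1)%g c).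
    apply/existsP; exists ((s^-1)%g a); rewrite !permKV mem_setU_of // bD ab bc.
    move: acS bad; rewrite !mem_inversions bc (ltn_trans ab bc) /= => -> /=.
    have : (s^-1 b != s^-1 c)%g by rewrite (inj_eq perm_inj) neq_ltn bc.
    rewrite -val_eqE /=; lia.
- apply/andP; split; apply/negP=> /existsP[p /existsP[q /existsP[r]]].
  + case/and5P=> pq qr rp spq pU; have pD := mem_setU_of (setU_of_interior pU).
    have := cl _ _ _ rp spq; rewrite -(negbK (_ \in setD_of o)) -pD pU /=.
    rewrite !mem_inversions !permK; lia.
  + case/and5P=> pq qr sqr srp rD.
    have := cl _ _ _ sqr srp; rewrite rD !mem_inversions !permK; lia.
Qed.

Lemma avoider_trim : trim (@avoider_le n o).
Proof.
apply: (@representation_trim n (setD_of o) _ _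
  (fun s : avoider o => inversions (val s))).
split=> //.
- by move=> s t /inversions_inj/val_inj.
- by move=> [s sP]; apply/avoiders_closed.
- move=> S cS; have [s Es] := biclosed_inversions (cambrian_closed_biclosed cS).
  have sP : s \in avoiders o by apply/avoiders_closed; rewrite Es.
  by exists (exist _ s sP).
Qed.

End Permutations.

(** * Hexagons of the weak order *)

Section Edges.

Variable n : nat.

(* A cover relation U < W of the weak order given by its inversion sets: the
   adjacent values a, c are swapped, and L collects the values between a and c
   which stand to the left of them. *)
Definition set_edge (L : {set 'I_n}) (a c : 'I_n) (U W : {set 'I_n * 'I_n}) :=
  [/\ (a, c) \notin U, W = (a, c) |: U
    & forall x : 'I_n, a < x -> x < c -> (x \in L) = ((a, x) \in U)].

Lemma rect_edge L (a c : 'I_n) : a < c ->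
  set_edge L a c (rect L a c :\ (a, c)) (rect L a c).
Proof.
move=> ac; split; first by rewrite !inE eqxx.
  by rewrite setD1K // mem_rect.
move=> x ax xc; rewrite in_setD1 xpair_eqE eqxx /= -val_eqE (ltn_eqF xc) /=.
apply/idP/rectP => [xL|[_ _ _ _ [Ex|//]]]; last by subst; lia.
by split=> //; [lia|left|right].
Qed.

(** The pairs [(a, y)] come from the label. For [x] strictly between [a] and [y] and outside [L],
    [(a, x)] is not in [w], so cotransitivity turns [(a, y)] into [(x, y)]. *)
Lemma edge_rect L (a c : 'I_n) (u w : 'S_n) : a < c ->
  set_edge L a c (inversions u) (inversions w) ->
  rect L a c \subset inversions w /\ rect L a c :\ (a, c) \subset inversions u.
Proof.
move=> ac [acu Ew EL].
have [sub tr cotr] := inversions_biclosed w.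
have mem_w (x : 'I_n) : a < x -> x < c -> ((a, x) \in inversions w) = (x \in L).
  by move=> ax xc; rewrite Ew in_setU1 xpair_eqE eqxx -val_eqE (ltn_eqF xc) EL.
have acw : (a, c) \in inversions w by rewrite Ew setU11.
suff rw : rect L a c \subset inversions w.
  by split=> //; rewrite subDset -Ew.
apply/subsetP=> -[x y] /rectP[ax xy yc hx hy].
have ayw : (a, y) \in inversions w.
  case: hy => [->//|yL]; have [->//|ne] := eqVneq y c.
  by rewrite mem_w //; move: ne; rewrite -val_eqE /=; lia.
case: hx => [->//|xL]; have [->//|ne] := eqVneq x a.
have ax' : a < x by move: ne; rewrite -val_eqE /=; lia.
by case: (cotr _ _ _ ax' xy ayw) => //; rewrite mem_w ?(negPf xL) //; lia.
Qed.

Section Hexagon.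

Variables (L : {set 'I_n}) (a q c : 'I_n).
Hypotheses (aq : a < q) (qc : q < c).

(* The word: L, then a, q, c in the order of the ranks i, j, k, then the rest. *)
Definition hex (i j k : nat) : {set 'I_n * 'I_n} :=
  rank_inversions (fun x =>
    if x == a then i else if x == q then j else if x == c then k
    else if x \in L then 0 else 4).

Ltac hex_cases :=
  rewrite ?inE /= ?xpair_eqE;
  repeat (let E := fresh in
    case: eqP => [E|?]; [have /= ? := congr1 val E; rewrite ?{}E|]);
  rewrite ?eqxx ?ltnn ?aq ?qc ?(ltn_trans aq qc) //=; try lia;
  repeat case: ifP => ? //=; try lia.

(** The two sides of the hexagon are aqc, acq, caq, cqa and aqc, qac, qca, cqa. Opposite end edges
    have the same label; the middle edges swap [a] and [c], with [q] on their left exactly on the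
    second side. *)
Lemma hex_edge_qc_bottom : set_edge L q c (hex 1 2 3) (hex 1 3 2).
Proof.
split.
- by hex_cases.
- by apply/setP=> -[x y]; hex_cases.
- by move=> x ? ?; hex_cases.
Qed.

Lemma hex_edge_qc_top : set_edge L q c (hex 3 1 2) (hex 3 2 1).
Proof.
split.
- by hex_cases.
- by apply/setP=> -[x y]; hex_cases.
- by move=> x ? ?; hex_cases.
Qed.

Lemma hex_edge_aq_bottom : set_edge L a q (hex 1 2 3) (hex 2 1 3).
Proof.
split.
- by hex_cases.
- by apply/setP=> -[x y]; hex_cases.
- by move=> x ? ?; hex_cases.
Qed.

Lemma hex_edge_aq_top : set_edge L a q (hex 2 3 1) (hex 3 2 1).
Proof.
split.
- by hex_cases.
- by apply/setP=> -[x y]; hex_cases.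
- by move=> x ? ?; hex_cases.
Qed.

Lemma hex_edge_ac_left : q \in L -> set_edge L a c (hex 2 1 3) (hex 3 1 2).
Proof.
move=> qL; split; [by hex_cases | by apply/setP=> -[x y]; hex_cases |].
by move=> x ? ?; hex_cases; rewrite qL aq.
Qed.

Lemma hex_edge_ac_right : q \notin L -> set_edge L a c (hex 1 3 2) (hex 2 3 1).
Proof.
move=> /negbTE qL; split; [by hex_cases | by apply/setP=> -[x y]; hex_cases |].
by move=> x ? ?; hex_cases; rewrite qL aq.
Qed.

(** Every inversion of the top except [(a, c)] is in one of the two lower words, and [(a, c)]
    follows by transitivity through [q]. *)
Lemma hex_join S : biclosed S -> hex 1 3 2 \subset S -> hex 2 1 3 \subset S ->
  hex 3 2 1 \subset S.
Proof.
move=> [_ tr _] /subsetP s132 /subsetP s213.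
have acS : (a, c) \in S.
  by apply: (tr a q c); [apply: s213 | apply: s132]; hex_cases.
apply/subsetP=> -[x y] xyH; have [[-> ->]//|ne] := eqVneq (x, y) (a, c).
suff /orP[/s132|/s213] : ((x, y) \in hex 1 3 2) || ((x, y) \in hex 2 1 3) by [].
by move: xyH ne; hex_cases.
Qed.

Lemma hex_meet S : biclosed S -> S \subset hex 2 3 1 -> S \subset hex 3 1 2 ->
  S \subset hex 1 2 3.
Proof.
move=> [_ _ cotr] /subsetP s231 /subsetP s312.
have acS : (a, c) \notin S.
  by apply/negP=> /(cotr _ _ _ aq qc)[/s231|/s312]; hex_cases.
apply/subsetP=> -[x y] xyS; have ne : (x, y) != (a, c).
  by apply: contraNneq acS => <-.
by move: (s231 _ xyS) (s312 _ xyS) ne; hex_cases.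
Qed.

Lemma hex_sub i j k i' j' k' : 0 < i < 4 -> 0 < j < 4 -> 0 < k < 4 ->
  0 < i' < 4 -> 0 < j' < 4 -> 0 < k' < 4 ->
  (j < i -> j' < i') -> (k < i -> k' < i') -> (k < j -> k' < j') ->
  hex i j k \subset hex i' j' k'.
Proof.
by move=> *; apply/subsetP=> -[x y]; hex_cases.
Qed.

End Hexagon.
End Edges.

(** * Forcing in congruences of the weak order *)

Section WeakOrderCongruence.

Variables (n : nat) (E : {set 'S_n * 'S_n}).
Hypothesis congE : lattice_congruence (@weak_le n) E.

Lemma congruence_refl s : (s, s) \in E.
Proof. by case/andP: congE => /and3P[/forallP]. Qed.

Lemma congruence_sym s t : (s, t) \in E -> (t, s) \in E.
Proof.
by case/andP: congE => /and3P[_ /'forall_'forall_implyP h _] _; apply: h.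
Qed.

Lemma congruence_trans s t u : (s, t) \in E -> (t, u) \in E -> (s, u) \in E.
Proof.
case/andP: congE => /and3P[_ _ /'forall_'forall_'forall_implyP h] _ st tu.
by apply: (h s t); rewrite st.
Qed.

Lemma congruence_op x x' y y' z z' : (x, x') \in E -> (y, y') \in E ->
  (is_join (@weak_le n) x y z && is_join (@weak_le n) x' y' z') ||
  (is_meet (@weak_le n) x y z && is_meet (@weak_le n) x' y' z') ->
  (z, z') \in E.
Proof.
move=> xx yy zz; case/andP: congE => _.
move=> /forallP/(_ x)/forallP/(_ x')/forallP/(_ y)/forallP/(_ y').
by move=> /forallP/(_ z)/forallP/(_ z'); rewrite xx yy zz.
Qed.

(** Join both members of [(t, x)] with [w]: the results are [w] and [v]. *)
Lemma congruence_push_up t x w v : (t, x) \in E -> weak_le t w ->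
  weak_le x v -> weak_le w v ->
  (forall u, weak_le x u -> weak_le w u -> weak_le v u) -> (w, v) \in E.
Proof.
move=> tx tw xv wv min; apply: congruence_op tx (congruence_refl w) _.
apply/orP; left; rewrite /is_join tw xv wv /weak_le subxx /=.
by apply/andP; split; apply/forallP=> u; apply/implyP=> /andP[] // ? ?; apply: min.
Qed.

Lemma congruence_push_down t x w v : (t, x) \in E -> weak_le w x ->
  weak_le v t -> weak_le v w ->
  (forall u, weak_le u t -> weak_le u w -> weak_le u v) -> (v, w) \in E.
Proof.
move=> tx wx vt vw max; apply: congruence_op tx (congruence_refl w) _.
apply/orP; right; rewrite /is_meet wx vt vw /weak_le subxx /=.
by apply/andP; split; apply/forallP=> u; apply/implyP=> /andP[] // ? ?; apply: max.
Qed.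

(** With the next lemma, this expresses that congruence classes are convex. *)
Lemma congruence_sub_right v w w' : (v, w) \in E ->
  weak_le v w' -> weak_le w' w -> (v, w') \in E.
Proof.
move=> vw vw' w'w.
by apply: congruence_push_down vw w'w _ vw' _ => //; apply: subxx.
Qed.

Lemma congruence_sub_left v w v' : (v, w) \in E ->
  weak_le v v' -> weak_le v' w -> (v', w) \in E.
Proof.
move=> vw vv' v'w.
by apply: congruence_push_up vw vv' _ v'w _ => //; apply: subxx.
Qed.

Definition contracts (L : {set 'I_n}) (a c : 'I_n) : Prop :=
  forall u w, set_edge L a c (inversions u) (inversions w) -> (u, w) \in E.

(* Every cover with this label is perspective to the one below [rect L a c]. *)
Lemma edge_contracts L (a c : 'I_n) u w : a < c ->
  set_edge L a c (inversions u) (inversions w) -> (u, w) \in E ->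
  contracts L a c.
Proof.
move=> ac uw uwE u' w' uw'.
have [j Ej] := biclosed_inversions (cambrian_closed_biclosed (rect_closed L a c)).
have [j' Ej'] := biclosed_inversions (cambrian_closed_biclosed (rectD1_closed L a c)).
have [jw ju] := edge_rect ac uw; have [jw' ju'] := edge_rect ac uw'.
have [acu Ew _] := uw; have [acu' Ew' _] := uw'.
have jE : (j', j) \in E.
  apply: congruence_push_down uwE _ _ _ _; rewrite /weak_le ?Ej ?Ej' ?subsetDl //.
  by move=> z zu zr; rewrite subsetD1 zr /=; apply: contra acu; apply: subsetP.
apply: congruence_push_up jE _ _ _ _; rewrite /weak_le ?Ej ?Ej' //.
  by rewrite Ew' subsetUr.
move=> z rz uz; rewrite Ew' subUset uz sub1set andbT.
by apply: (subsetP rz); rewrite mem_rect.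
Qed.

Lemma hex_perm L (a q c : 'I_n) i j k :
  exists s : 'S_n, inversions s = hex L a q c i j k.
Proof. exact: biclosed_inversions (rank_inversions_biclosed _). Qed.

(** The membership of [q] in [L] selects the side whose middle edge has the label of [(a, c)]. Of
    the two end edges with the contracted label, take the one on the other side; a join or a meet
    carries it to three consecutive edges' worth of hexagon containing that middle edge, which is
    then contracted by convexity. *)
Lemma hexagon_contracts L (a q c : 'I_n) : a < q -> q < c ->
  contracts L a q \/ contracts L q c -> contracts L a c.
Proof.
move=> aq qc hyp; have ac := ltn_trans aq qc.
have [s123 E123] := hex_perm L a q c 1 2 3.
have [s132 E132] := hex_perm L a q c 1 3 2.
have [s213 E213] := hex_perm L a q c 2 1 3.
have [s231 E231] := hex_perm L a q c 2 3 1.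
have [s312 E312] := hex_perm L a q c 3 1 2.
have [s321 E321] := hex_perm L a q c 3 2 1.
have E_ := (E123, E132, E213, E231, E312, E321).
have join u : weak_le s132 u -> weak_le s213 u -> weak_le s321 u.
  by rewrite /weak_le !E_; apply: hex_join => //; apply: inversions_biclosed.
have meet u : weak_le u s231 -> weak_le u s312 -> weak_le u s123.
  by rewrite /weak_le !E_; apply: hex_meet => //; apply: inversions_biclosed.
have [qL|qL] := boolP (q \in L).
  suff sE : (s213, s312) \in E.
    by apply: edge_contracts sE => //; rewrite !E_; apply: hex_edge_ac_left.
  case: hyp => h.
    have sE : (s231, s321) \in E by apply: h; rewrite !E_; apply: hex_edge_aq_top.
    have sE' : (s123, s312) \in E.
      apply: congruence_push_down sE _ _ _ meet;
        rewrite /weak_le !E_; exact: hex_sub.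
    by apply: congruence_sub_left sE' _ _; rewrite /weak_le !E_; apply: hex_sub.
  have sE : (s123, s132) \in E by apply: h; rewrite !E_; apply: hex_edge_qc_bottom.
  have sE' : (s213, s321) \in E.
    by apply: congruence_push_up sE _ _ _ join; rewrite /weak_le !E_; apply: hex_sub.
  by apply: congruence_sub_right sE' _ _; rewrite /weak_le !E_; apply: hex_sub.
suff sE : (s132, s231) \in E.
  by apply: edge_contracts sE => //; rewrite !E_; apply: hex_edge_ac_right.
case: hyp => h.
  have sE : (s123, s213) \in E by apply: h; rewrite !E_; apply: hex_edge_aq_bottom.
  have sE' : (s132, s321) \in E.
    apply: congruence_push_up sE _ _ _ (fun u h1 h2 => join u h2 h1);
      rewrite /weak_le !E_; exact: hex_sub.
  by apply: congruence_sub_right sE' _ _; rewrite /weak_le !E_; apply: hex_sub.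
have sE : (s312, s321) \in E by apply: h; rewrite !E_; apply: hex_edge_qc_top.
have sE' : (s123, s231) \in E.
  apply: congruence_push_down sE _ _ _ (fun u h1 h2 => meet u h2 h1);
    rewrite /weak_le !E_; exact: hex_sub.
by apply: congruence_sub_left sE' _ _; rewrite /weak_le !E_; apply: hex_sub.
Qed.

End WeakOrderCongruence.

(** * The contracted pairs of generators as rectangles *)

Section Generators.

Variables (n : nat) (i : 'I_n).
Hypothesis i_interior : 0 < i < n.-1.

Lemma val_ord_pred : ord_pred i = i.-1 :> nat.
Proof.
rewrite /=; have -> : (i + n).-1 = i.-1 + n by lia.
by rewrite modnDr modn_small //; lia.
Qed.

Lemma val_ordS : ordS i = i.+1 :> nat.
Proof. by rewrite /= modn_small //; lia. Qed.

Lemma val_gen_before (x : 'I_n) : gen_before i x =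
  (if x == i.-1 :> nat then i : nat else if x == i :> nat then i.-1 else x) :> nat.
Proof.
rewrite /gen_before; case: tpermP => [->|->|ne1 ne2].
- by rewrite val_ord_pred eqxx.
- by rewrite val_ord_pred eqxx; case: eqP => //; lia.
- case: eqP => [Ex|_]; first by case: ne1; apply: ord_inj; rewrite val_ord_pred.
  by case: eqP => [Ex|//]; case: ne2; apply: val_inj.
Qed.

Lemma val_gen_after (x : 'I_n) : gen_after i x =
  (if x == i :> nat then i.+1 else if x == i.+1 :> nat then i : nat else x) :> nat.
Proof.
rewrite /gen_after; case: tpermP => [->|->|ne1 ne2].
- by rewrite val_ordS eqxx.
- by rewrite val_ordS eqxx; case: eqP => //; lia.
- case: eqP => [Ex|_]; first by case: ne1; apply: val_inj.
  by case: eqP => [Ex|//]; case: ne2; apply: ord_inj; rewrite val_ordS.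
Qed.

Lemma eq_ord_pred (x : 'I_n) : (x == ord_pred i) = (x == i.-1 :> nat).
Proof. by rewrite -val_ord_pred. Qed.

Lemma eq_ordS (x : 'I_n) : (x == ordS i) = (x == i.+1 :> nat).
Proof. by rewrite -val_ordS. Qed.

Lemma mem_rect_interior L (x y : 'I_n) :
  ((x, y) \in rect L (ord_pred i) (ordS i)) =
  [&& i.-1 <= x, x < y, y <= i.+1,
      (x == i.-1 :> nat) || (i \notin L)
    & (y == i.+1 :> nat) || (i \in L)].
Proof.
rewrite inE /fst /snd eq_ord_pred eq_ordS val_ord_pred val_ordS.
case: (leqP i.-1 x) => //= x1; case: (ltnP x y) => //= xy.
case: (leqP y i.+1) => //= y1.
case: (eqVneq (x : nat) i.-1) => /= Ex.
  case: (eqVneq (y : nat) i.+1) => //= Ey; congr (_ \in L).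
  by apply: val_inj => /=; move: Ey; lia.
have -> : x = i by apply: val_inj => /=; move: Ex; lia.
by case: (eqVneq (y : nat) i.+1) => //= Ey; exfalso; move: Ey Ex; lia.
Qed.

(** The four lemmas from here on identify each contracted pair with the rectangle from i - 1 to i +
    1, without and with its widest pair. Only [i] is strictly between the ends, so [L] enters
    through [i] alone. *)
Lemma inversions_gen_after (L : {set 'I_n}) : i \notin L ->
  inversions (gen_after i) =
  rect L (ord_pred i) (ordS i) :\ (ord_pred i, ordS i).
Proof.
move=> iL; apply/setP=> -[x y]; rewrite in_setD1 mem_rect_interior xpair_eqE.
rewrite eq_ord_pred eq_ordS.
rewrite mem_inversions tpermV !val_gen_after (negPf iL) /=.
by repeat case: eqP => ?; lia.
Qed.

Lemma inversions_gen_before (L : {set 'I_n}) : i \in L ->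
  inversions (gen_before i) =
  rect L (ord_pred i) (ordS i) :\ (ord_pred i, ordS i).
Proof.
move=> iL; apply/setP=> -[x y]; rewrite in_setD1 mem_rect_interior xpair_eqE.
rewrite eq_ord_pred eq_ordS.
rewrite mem_inversions tpermV !val_gen_before iL /=.
by repeat case: eqP => ?; lia.
Qed.

Lemma inversions_gen_before_after (L : {set 'I_n}) : i \notin L ->
  inversions (gen_before i * gen_after i)%g = rect L (ord_pred i) (ordS i).
Proof.
move=> iL; apply/setP=> -[x y]; rewrite mem_rect_interior.
rewrite mem_inversions invMg !permM !tpermV !val_gen_before (negPf iL) /=.
rewrite -/(gen_after i); have := val_gen_after x; have := val_gen_after y.
by repeat case: eqP => ?; lia.
Qed.

Lemma inversions_gen_after_before (L : {set 'I_n}) : i \in L ->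
  inversions (gen_after i * gen_before i)%g = rect L (ord_pred i) (ordS i).
Proof.
move=> iL; apply/setP=> -[x y]; rewrite mem_rect_interior.
rewrite mem_inversions invMg !permM !tpermV !val_gen_after iL /=.
rewrite -/(gen_before i); have := val_gen_before x; have := val_gen_before y.
by repeat case: eqP => ?; lia.
Qed.

End Generators.

(** * The Cambrian congruence *)

Section CambrianCongruence.

Variables (n : nat) (o : orientation n).
Let D := setD_of o.

(** No [D]-rectangle inside [rect L a c] contains [(a, c)]: it would contain [(a, b)] if [b] is in
    [D] and [(b, c)] if not, and that pair is missing from [rect L a c]. *)
Lemma core_rectD1 (L : {set 'I_n}) (a b c : 'I_n) : a < b -> b < c ->
  (b \in L) != (b \in D) -> core D (rect L a c :\ (a, c)) = core D (rect L a c).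
Proof.
move=> ab bc bLD; apply/eqP; rewrite eqEsubset coreS ?subsetDl //=.
apply/subsetP=> -[x y]; rewrite !inE /= => /andP[xy xyL]; rewrite xy subsetD1 xyL /=.
apply/negP=> /rect_subset acD; move: bLD (subset_trans acD xyL) => + /subsetP sub.
case: (boolP (b \in D)) => bD.
  have /sub/rectP[_ _ _ _ [Eb|-> //]] : (a, b) \in rect D a c.
    by apply/rectP; split=> //; [exact: ltnW | left | right].
  by subst; lia.
have /sub/rectP[_ _ _ [Eb|/negPf-> //] _] : (b, c) \in rect D a c.
  by apply/rectP; split=> //; [exact: ltnW | right | left].
by subst; lia.
Qed.

Definition same_core : {set 'S_n * 'S_n} :=
  [set st : 'S_n * 'S_n | core D (inversions st.1) == core D (inversions st.2)].

Lemma mem_same_core s t :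
  ((s, t) \in same_core) = (core D (inversions s) == core D (inversions t)).
Proof. by rewrite inE. Qed.

Lemma core_inversions S : biclosed S ->
  exists2 u : 'S_n, inversions u = core D S & core D (inversions u) = core D S.
Proof.
move=> bS; have cS := core_closed D bS.
have [u Eu] := biclosed_inversions (cambrian_closed_biclosed cS).
by exists u => //; rewrite Eu core_id.
Qed.

(** The largest permutation [u] with the core of [z'] is above [x'] and [y'], and also above [x] and
    [y], because lying below [u] depends on the core alone. So it is above [z]. *)
Lemma same_core_join x x' y y' z z' :
  core D (inversions x) = core D (inversions x') ->
  core D (inversions y) = core D (inversions y') ->
  is_join (@weak_le n) x y z -> is_join (@weak_le n) x' y' z' ->
  core D (inversions z) \subset core D (inversions z').
Proof.
move=> xx yy /and3P[_ _ /forallP minz] /and3P[xz' yz' _].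
set K := avoiding (~: D) (inversions z').
have cK : cambrian_closed (~: D) K.
  by apply: avoiding_closed; case: (inversions_biclosed z').
(* u is the largest permutation congruent to z' *)
have [u Eu] := biclosed_inversions (biclosedC (cambrian_closed_biclosed cK)).
have below s s' : core D (inversions s) = core D (inversions s') ->
    weak_le s' z' -> weak_le s u.
  move=> ss s'z; rewrite /weak_le Eu subsetD; apply/andP; split.
    by case: (inversions_biclosed s).
  rewrite disjoint_sym; apply: disjointWl (avoiding_disjoint (~: D) _).
  rewrite -(avoiding_core _ (inversions_biclosed s)) ss.
  by rewrite avoiding_core ?avoidingS //; apply: inversions_biclosed.
have := minz u; rewrite !(below _ _ xx, below _ _ yy) //=.
rewrite /weak_le Eu subsetD => /andP[_ zK].
rewrite -!avoidingK_core; try exact: inversions_biclosed.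
apply/avoidingS/subsetP=> -[p q] pqK; rewrite !inE /=.
have [subK _ _] := cK; rewrite (in_increasing subK pqK) /=.
by apply: disjointWl (rect_min cK pqK) _; rewrite disjoint_sym.
Qed.

(** Dually, the smallest permutation with the core of [z'] is below [x] and [y], hence below [z]. *)
Lemma same_core_meet x x' y y' z z' :
  core D (inversions x) = core D (inversions x') ->
  core D (inversions y) = core D (inversions y') ->
  is_meet (@weak_le n) x y z -> is_meet (@weak_le n) x' y' z' ->
  core D (inversions z') \subset core D (inversions z).
Proof.
move=> xx yy /and3P[_ _ /forallP maxz] /and3P[z'x' z'y' _].
have [u Eu cu] := core_inversions (inversions_biclosed z').
have below s s' : core D (inversions s) = core D (inversions s') ->
    weak_le z' s' -> weak_le u s.
  move=> ss z's; rewrite /weak_le Eu; apply: subset_trans (core_sub D _).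
  by rewrite ss coreS.
have := maxz u; rewrite !(below _ _ xx, below _ _ yy) //=.
by rewrite /weak_le -cu; apply: coreS.
Qed.

Lemma same_core_congruence : lattice_congruence (@weak_le n) same_core.
Proof.
apply/andP; split.
  apply/and3P; split.
  - by apply/forallP=> s; rewrite mem_same_core.
  - apply/'forall_forallP=> s t; rewrite !mem_same_core eq_sym.
    exact: implybb.
  - apply/'forall_'forall_forallP=> s t u; rewrite !mem_same_core.
    by apply/implyP=> /andP[/eqP->].
apply/forallP=> x; apply/forallP=> x'; apply/forallP=> y; apply/forallP=> y'.
apply/forallP=> z; apply/forallP=> z'; rewrite !mem_same_core.
apply/implyP=> /andP[/eqP xx /eqP yy]; apply/implyP=> /orP[]/andP[h h'].
  by rewrite eqEsubset (same_core_join xx yy h h')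
    (same_core_join (esym xx) (esym yy) h' h).
by rewrite eqEsubset (same_core_meet (esym xx) (esym yy) h' h)
  (same_core_meet xx yy h h').
Qed.

Lemma contracted_same_core : contracted_pairs o \subset same_core.
Proof.
rewrite subUset; apply/andP; split; apply/subsetP=> _ /imsetP[i iDU ->];
    rewrite mem_same_core.
  have i_int := setD_of_interior iDU.
  (* The label must disagree with [D] at [i]: [set0] does so for [i] in [D], and [setT] below for
     [i] in [U]. *)
  rewrite (@inversions_gen_after _ _ i_int set0) ?inE //.
  rewrite (@inversions_gen_before_after _ _ i_int set0) ?inE //.
  rewrite (@core_rectD1 _ _ i) ?val_ord_pred ?val_ordS //; first by lia.
  by rewrite inE /D iDU.
have i_int := setU_of_interior iDU.
rewrite (@inversions_gen_before _ _ i_int setT) ?inE //.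
rewrite (@inversions_gen_after_before _ _ i_int setT) ?inE //.
rewrite (@core_rectD1 _ _ i) ?val_ord_pred ?val_ordS //; first by lia.
by move: iDU; rewrite mem_setU_of // inE -/D => /negPf->.
Qed.

(** A contracted generator pair settles the ends b - 1 and b + 1; one hexagon then moves the right
    end to [c], and another the left end to [a]. *)
Lemma contracts_mismatch E (L : {set 'I_n}) (a b c : 'I_n) :
  lattice_congruence (@weak_le n) E -> contracted_pairs o \subset E ->
  a < b -> b < c -> (b \in L) != (b \in D) -> contracts E L a c.
Proof.
move=> congE subE ab bc bLD; have b_int : 0 < b < n.-1 by have := ltn_ord c; lia.
have Ep := val_ord_pred b_int; have Es := val_ordS b_int.
have pb : ord_pred b < b by rewrite Ep; lia.
have bs : b < ordS b by rewrite Es.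
have base : contracts E L (ord_pred b) (ordS b).
  have := rect_edge L (ltn_trans pb bs).
  have [bD|bD] := boolP (b \in D).
    have bL : b \notin L by move: bLD; rewrite bD; case: (b \in L).
    rewrite -{1}inversions_gen_after // -inversions_gen_before_after // => edge.
    apply: edge_contracts edge _ => //; first exact: ltn_trans pb bs.
    by apply: (subsetP subE); rewrite inE imset_f.
  have bL : b \in L by move: bLD; rewrite (negPf bD); case: (b \in L).
  rewrite -{1}inversions_gen_before // -inversions_gen_after_before // => edge.
  apply: edge_contracts edge _ => //; first exact: ltn_trans pb bs.
  apply: (subsetP subE); rewrite inE orbC.
  rewrite (imset_f (fun i => (gen_before i, (gen_after i * gen_before i)%g))) //.
  by rewrite mem_setU_of.
have right : contracts E L (ord_pred b) c.
  have [->//|ne] := eqVneq c (ordS b).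
  apply: (hexagon_contracts congE (q := ordS b)); last by left.
    exact: ltn_trans pb bs.
  by move: ne; rewrite eq_ordS // Es; lia.
have [->//|ne] := eqVneq a (ord_pred b).
apply: (hexagon_contracts congE (q := ord_pred b)); last by right.
  by move: ne; rewrite eq_ord_pred // Ep; lia.
exact: ltn_trans bc.
Qed.

End CambrianCongruence.

(** * Contraction to avoiders and the Cambrian quotient *)

Section CambrianLattice.

Variables (n : nat) (o : orientation n).
Let D := setD_of o.

Definition bad_triple (s : 'S_n) (a b c : 'I_n) : bool :=
  [&& a < b, b < c, (s^-1)%g c < (s^-1)%g a
    & if b \in D then (s^-1)%g a < (s^-1)%g b else (s^-1)%g b < (s^-1)%g c].

Lemma nonavoider_bad_triple s :
  s \notin avoiders o -> exists a b c, bad_triple s a b c.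
Proof.
rewrite inE negb_and !negbK => /orP[] /existsP[p /existsP[q /existsP[r]]].
  case/and5P=> pq qr rp spq pU; exists (s r), (s p), (s q).
  have pD := mem_setU_of o (setU_of_interior pU); rewrite pU in pD.
  by rewrite /bad_triple !permK rp spq qr -[_ \in D]negbK -pD /=.
case/and5P=> pq qr sqr srp rD; exists (s q), (s r), (s p).
by rewrite /bad_triple !permK sqr srp pq /D rD qr.
Qed.

(** A letter placed between [c] and [a] replaces [a] if it is smaller than [b] and [c] if it is
    larger; it is not [b], which stands outside that stretch of the word. *)
Lemma adjacent_bad_triple s a b c : bad_triple s a b c ->
  exists a' c', bad_triple s a' b c' /\
    forall x, ~~ (((s^-1)%g c' < (s^-1)%g x) && ((s^-1)%g x < (s^-1)%g a')).
Proof.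
have [m] := ubnP ((s^-1)%g a - (s^-1)%g c); elim: m a c => // m IH a c lem bad.
have [/existsP[x /andP[cx xa]]|none] :=
    boolP [exists x, ((s^-1)%g c < (s^-1)%g x) && ((s^-1)%g x < (s^-1)%g a)]; last first.
  by exists a, c; split=> // x; apply: contra none => h; apply/existsP; exists x.
case/and4P: bad => ab bc ca.
have [xb|bx|/val_inj Ex] := ltngtP x b.
- move=> h; apply: (IH x c); first by clear -lem cx xa; lia.
  by rewrite /bad_triple xb bc cx /=; case: ifP h => // _; apply: ltn_trans.
- move=> h; apply: (IH a x); first by clear -lem cx xa; lia.
  by rewrite /bad_triple ab bx xa /=; case: ifP h => // _ /ltn_trans; apply.
- by subst x; case: ifP => _; rewrite ltnNge ltnW.
Qed.

Lemma contract_step s : s \notin avoiders o ->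
  exists u, #|inversions u| < #|inversions s| /\
    forall E, lattice_congruence (@weak_le n) E ->
      contracted_pairs o \subset E -> (u, s) \in E.
Proof.
move=> /nonavoider_bad_triple[a0 [b [c0]]] /adjacent_bad_triple[a [c [bad adj]]].
case/and4P: bad => ab bc ca hb; have ac := ltn_trans ab bc.
have [sub tr cotr] := inversions_biclosed s.
have acS : (a, c) \in inversions s by rewrite mem_inversions ac.
have neq_pos (x y : 'I_n) : x < y -> (s^-1)%g x != (s^-1)%g y :> nat.
  by move=> xy; rewrite (inj_eq val_inj) (inj_eq perm_inj) neq_ltn xy.
(* Since [c] and [a] are adjacent in the word, swapping them removes this single inversion. *)
have bU : biclosed (inversions s :\ (a, c)).
  split; first exact: subset_trans (subsetDl _ _) sub.
  - move=> x y z /setD1P[_ xyS] /setD1P[_ yzS]; rewrite in_setD1 (tr _ _ _ xyS yzS) andbT.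
    apply/eqP=> -[Ex Ez]; subst x z; case/negP: (adj y).
    by move: xyS yzS; rewrite !mem_inversions => /andP[_ ->] /andP[_ ->].
  - move=> x y z xy yz /setD1P[xzne xzS]; rewrite !in_setD1.
    have xzpos : (s^-1)%g z < (s^-1)%g x.
      by move: xzS; rewrite mem_inversions => /andP[].
    have [[Ex Ey]|xyne] := (x, y) =P (a, c).
      subst x y; right; rewrite xpair_eqE negb_and eq_sym neq_ltn ac mem_inversions yz.
      by move: (adj z) (neq_pos _ _ yz) xzpos; clear; lia.
    have [[Ey Ez]|yzne] := (y, z) =P (a, c).
      subst y z; left; rewrite mem_inversions xy /=.
      by move: (adj x) (neq_pos _ _ xy) xzpos; clear; lia.
    by case: (cotr _ _ _ xy yz xzS); [left | right].
have [u Eu] := biclosed_inversions bU.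
exists u; split.
  by apply: proper_card; rewrite Eu properD1.
move=> E congE subE; pose L := [set x | (a, x) \in inversions u].
have mismatch : (b \in L) != (b \in D).
  rewrite inE Eu in_setD1 xpair_eqE eqxx -val_eqE (ltn_eqF bc) /= mem_inversions ab /=.
  move: hb; case: (b \in D) => hb; first by rewrite ltnNge (ltnW hb).
  by rewrite (ltn_trans hb ca).
apply: (contracts_mismatch congE subE ab bc mismatch); split.
- by rewrite Eu !inE eqxx.
- by rewrite Eu setD1K.
- by move=> x _ _; rewrite inE.
Qed.

(** The avoider is chosen before [E], so that it can be identified by taking [same_core] for [E]. *)
Lemma contract_to_avoider s :
  exists2 v, v \in avoiders o &
    forall E, lattice_congruence (@weak_le n) E ->
      contracted_pairs o \subset E -> (v, s) \in E.
Proof.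
have [m] := ubnP #|inversions s|; elim: m s => // m IH s lem.
have [sB|sB] := boolP (s \in avoiders o).
  by exists s => // E congE _; apply: congruence_refl congE _.
have [u [us uE]] := contract_step sB.
have [|v vB vE] := IH u; first exact: leq_trans us lem.
by exists v => // E congE subE; apply: congruence_trans (vE E _ _) (uE E _ _).
Qed.

(** Permutations with the same core contract to avoiders with that core. An avoider is determined by
    its core, so the two avoiders coincide and every admissible [E] relates the permutations. *)
Lemma cambrian_congruenceE : cambrian_congruence o = same_core o.
Proof.
apply/eqP; rewrite eqEsubset; apply/andP; split.
  by apply: bigcap_inf; rewrite same_core_congruence contracted_same_core.
apply/bigcapsP=> E /andP[congE subE]; apply/subsetP=> -[s t] st.
have [v vB vE] := contract_to_avoider s; have [w wB wE] := contract_to_avoider t.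
have core_avoider x y : x \in avoiders o ->
    (forall E, lattice_congruence (@weak_le n) E ->
      contracted_pairs o \subset E -> (x, y) \in E) -> inversions x = core D (inversions y).
  move=> /avoiders_closed/core_id {1}<- h; apply/eqP; rewrite -mem_same_core.
  by apply: h; [exact: same_core_congruence | exact: contracted_same_core].
have vw : v = w.
  apply: inversions_inj; rewrite (core_avoider _ _ vB vE) (core_avoider _ _ wB wE).
  by move: st; rewrite mem_same_core => /eqP.
have := vE E congE subE; rewrite vw => /(congruence_sym congE) sw.
exact: congruence_trans congE _ _ _ sw (wE E congE subE).
Qed.

Lemma cambrian_trim : trim (@cambrian_le n o).
Proof.
(* All terms of this union are equal; it names the core of a class without choosing a
   representative. *)
pose I (A : cambrian o) := \bigcup_(s in val A) core D (inversions s).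
have classP (A : cambrian o) : exists s, forall t,
    (t \in val A) = (core D (inversions s) == core D (inversions t)).
  case: A => A /= /imsetP[s _ ->]; exists s => t.
  by rewrite !inE cambrian_congruenceE mem_same_core.
have IE (A : cambrian o) s : s \in val A -> I A = core D (inversions s).
  have [t tA] := classP A; rewrite tA => /eqP ts.
  apply/eqP; rewrite eqEsubset; apply/andP; split; last first.
    by apply: (bigcup_max s) => //; rewrite tA ts.
  by apply/bigcupsP=> r; rewrite tA ts => /eqP->.
(* The least element of the class; these representatives give the comparison of classes from the
   inclusion of their cores. *)
have bottom (A : cambrian o) : exists2 s, s \in val A & inversions s = I A.
  have [t tA] := classP A.
  have [u Eu cu] := core_inversions o (inversions_biclosed t).
  by exists u; rewrite ?tA ?cu // Eu (IE _ t) // tA.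
apply: (@representation_trim n D _ _ I); split.
- move=> A B AB; apply: val_inj; apply/setP=> t.
  have [s sA] := classP A; have [r rB] := classP B.
  by rewrite sA rB -(IE A) ?sA // AB (IE B r) // rB.
- move=> A; have [s sA _] := bottom A; rewrite (IE A s sA).
  exact: core_closed (inversions_biclosed s).
- move=> S cS; have [u Eu] := biclosed_inversions (cambrian_closed_biclosed cS).
  have AP : [set t in [set: 'S_n] | (u, t) \in cambrian_congruence o]
      \in classes_of (cambrian_congruence o) by apply: imset_f.
  exists (exist (fun A : {set 'S_n} => A \in classes_of _) _ AP).
  rewrite (IE _ u) ?Eu ?core_id //=.
  by rewrite inE in_setT /= cambrian_congruenceE mem_same_core.
- move=> A B; apply/existsP/idP => [[s /andP[sA /existsP[t /andP[tB st]]]]|AB].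
    by rewrite (IE A s sA) (IE B t tB); apply: coreS.
  have [s sA Es] := bottom A; have [t tB Et] := bottom B.
  exists s; rewrite sA; apply/existsP; exists t.
  by rewrite tB /weak_le Es Et.
Qed.

End CambrianLattice.

Theorem theorem9 (n : nat) (n_ge2 : 2 <= n) (o : orientation n) :
  trim (@cambrian_le n o) /\ trim (@avoider_le n o).
Proof. by split; [apply: cambrian_trim | apply: avoider_trim]. Qed.
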